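(* Let $P=(P_0,\dots,P_{2n-1})$ be a CPPOS and $p\in\operatorname{int}(P)$. Fix a cell of the pencil through $p$ on which the two endpoints of the original chord lie in the open sides $e_i$ and $e_j$. Parametrise the original endpoints by $x(s)=P_i+se_i$ and $y(t)=P_j+te_j$. Then $$t(s)=\frac{N_0+sN_1}{\Delta_0+s\Delta_1},$$ where $\Delta_0=[P_i-p,e_j]$, $\Delta_1=[e_i,e_j]$, $N_0=-[P_i-p,P_j-p]$ and $N_1=-[e_i,P_j-p]$. Define $$u_0=\widehat{P_{i+n}},\quad u_1=\widehat{e_{i+n}},\quad v_0=\Delta_0\widehat{P_{j+n}}+N_0\widehat{e_{j+n}},\quad v_1=\Delta_1\widehat{P_{j+n}}+N_1\widehat{e_{j+n}}.$$ The homogeneous coefficients of the reflected line can be chosen as $$\boldsymbol\ell(s)=(u_0+su_1)\times(v_0+sv_1)=\boldsymbol\ell_0+s\boldsymbol\ell_1+s^2\boldsymbol\ell_2,$$ where $\boldsymbol\ell_0=u_0\times v_0$, $\boldsymbol\ell_1=u_0\times v_1+u_1\times v_0$ and $\boldsymbol\ell_2=u_1\times v_1$. Consequently, at every regular value of $s$, the exact envelope point has homogeneous coordinates $$\widehat Z(s)=\boldsymbol\ell_0\times\boldsymbol\ell_1+2s\,\boldsymbol\ell_0\times\boldsymbol\ell_2+s^2\,\boldsymbol\ell_1\times\boldsymbol\ell_2.$$ After division by the third coordinate, this is a rational parametrisation of a conic or a degeneration of a conic. If no line through $p$ contains two vertices of $P$, the pencil has exactly $2n$ combinatorial cells. Thus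 the completed $\operatorname{ART}_P(p)$ consists of at most $2n$ conic arcs and $2n$ transition segments.
   Context: A CPPOS (convex polygon with parallel opposite sides) is a positively oriented convex polygon $P=(P_0,\dots,P_{2n-1})$, indices modulo $2n$, all $P_i$ genuine vertices (consecutive edge vectors linearly independent), whose edge vectors $e_i=P_{i+1}-P_i$ satisfy $e_{i+n}\parallel e_i$. $P$ also denotes the closed convex region bounded by it. ''Side $e_i$'' means the side $[P_i,P_{i+1}]$. Boundary involution: $\sigma_P:\partial P\to\partial P$, $\sigma_P(P_i+s e_i)=P_{i+n}+s e_{i+n}$, $0\le s\le1$. For a line $\ell$ meeting $\operatorname{int}(P)$ with boundary intersection points $x_\ell,y_\ell$ (the endpoints of the original chord), the reflected line is $\Phi_P(\ell)=\overline{\sigma_P(x_\ell)\sigma_P(y_\ell)}$. $\Lambda_p$ is the pencil of lines through $p$. A (combinatorial) cell is a maximal open arc of $\Lambda_p$ on which the two boundary points of the line lie in two fixed open sides. On each cell one takes the envelope of the reflected lines: if $\boldsymbol\ell(s)\in\mathbb{R}^3\setminus\{0\}$ are homogeneous line coordinates, the envelope point is $[\boldsymbol\ell(s)\times\boldsymbol\ell'(s)]$ (regular value of $s$: this product is nonzero). At a cell transition (a line of $\Lambda_p$ through a vertex) the two one-sided envelope points lie on the same reflected line and the segment joining them (the transition segment) is added. The completed affine reflection transform $\operatorname{ART}_P(p)$ is the union of the cellwise envelopes and the transition segments. Notation: $[u,v]=\det(u,v)$ for $u,v\in\mathbb{R}^2$; homogeneous lifts are $\widehat x=(x,1)$ for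 an affine point $x$ (such as $P_k$) and $\widehat v=(v,0)$ for a vector $v$ (such as $e_k$); $\times$ is the cross product in $\mathbb{R}^3$. *)

(* Defs.v *)
From HB Require Import structures.
From mathcomp Require Import all_boot all_order all_algebra.
From mathcomp Require Import all_classical all_reals all_analysis.
Set Implicit Arguments.
Unset Strict Implicit.
Unset Printing Implicit Defensive.
Import Order.TTheory GRing.Theory Num.Theory.
Import numFieldNormedType.Exports.
Local Open Scope classical_set_scope.
Local Open Scope ring_scope.

Section Plane.
Variable R : realType.
Implicit Types (u v x y z : 'rV[R]_2) (w l : 'rV[R]_3).

Definition det2 u v : R := \det (col_mx u v : 'M[R]_2).

Definition lin_indep u v : bool := row_free (col_mx u v).

(* Meant for nonzero [u] and [v]. *)
Definition parallel u v : Prop := exists2 c : R, c != 0 & v = c *: u.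

(* The line through [x] and [y], when [x != y]. *)
Definition line x y : set 'rV[R]_2 := [set z | exists t : R, z = x + t *: (y - x)].

Definition segment x y : set 'rV[R]_2 :=
  [set z | exists2 t : R, 0 <= t <= 1 & z = x + t *: (y - x)].

Definition lift_pt x : 'rV[R]_3 := row_mx x (const_mx 1 : 'rV[R]_1).
Definition lift_vec v : 'rV[R]_3 := row_mx v (0 : 'rV[R]_1).

Definition cross w l : 'rV[R]_3 :=
  \row_(k < 3) [:: w 0 1 * l 0 2%:R - w 0 2%:R * l 0 1;
                   w 0 2%:R * l 0 0 - w 0 0 * l 0 2%:R;
                   w 0 0 * l 0 1 - w 0 1 * l 0 0]`_k.

(* Both vectors are homogeneous coordinates of one and the same point of the
   projective plane. *)
Definition same_point w l : Prop :=
  w != 0 /\ exists2 c : R, c != 0 & l = c *: w.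

(* The affine point with homogeneous coordinates [w]; meant for
   [w 0 2%:R != 0]. *)
Definition affine w : 'rV[R]_2 := (w 0 2%:R)^-1 *: lsubmx (w : 'rV[R]_(2 + 1)).

Definition line_coords l (L : set 'rV[R]_2) : Prop :=
  l != 0 /\ L = [set z | lift_pt z *m l^T = 0].

(* [w] is a vector of homogeneous coordinates of the point at parameter [s] of
   the envelope of the one-parameter family of lines [F].  The family is given
   by point sets, so any differentiable choice [l] of homogeneous line
   coordinates may be used; another choice only rescales [l s \x l' s]. *)
Definition envelope_pt (F : R -> set 'rV[R]_2) (s : R) w : Prop :=
  exists l : R -> 'rV[R]_3,
    [/\ \forall r \near s, line_coords (l r) (F r),
        derivable l s 1,
        cross (l s) (derive1 l s) != 0
      & same_point (cross (l s) (derive1 l s)) w].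

Definition qcurve (c0 c1 c2 : 'rV[R]_3) (s : R) : 'rV[R]_3 :=
  c0 + s *: c1 + s ^+ 2 *: c2.

(* The value of [qcurve c0 c1 c2] at the parameter [s = oo] is [c2]. *)
Definition param_conic (c0 c1 c2 : 'rV[R]_3) : Prop :=
  exists Q : 'M[R]_3,
    [/\ Q^T = Q, \det Q != 0
      & forall w, w != 0 ->
          (w *m Q *m w^T = 0 <->
             same_point c2 w \/ exists s, same_point (qcurve c0 c1 c2 s) w)].

(* The conic degenerates: the curve stays on a line (or reduces to a point). *)
Definition param_degenerate_conic (c0 c1 c2 : 'rV[R]_3) : Prop :=
  exists2 l : 'rV[R]_3, l != 0 & forall s, qcurve c0 c1 c2 s *m l^T = 0.

Definition conic_arc (A : set 'rV[R]_2) : Prop :=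
  exists c0 c1 c2 : 'rV[R]_3, exists a b : R,
    [/\ param_conic c0 c1 c2 \/ param_degenerate_conic c0 c1 c2,
        a < b,
        forall s, a < s < b -> qcurve c0 c1 c2 s 0 2%:R != 0
      & A = [set affine (qcurve c0 c1 c2 s) | s in `]a, b[]].

End Plane.

(* The indices modulo 2n form ['Z_(n.*2)], which has 2n elements for [0 < n]. *)
Section Polygon.
Variables (R : realType) (n : nat) (P : 'Z_(n.*2) -> 'rV[R]_2).
Implicit Types (i j k : 'Z_(n.*2)) (x y z p : 'rV[R]_2) (L : set 'rV[R]_2).

Definition edge i : 'rV[R]_2 := P (i + 1) - P i.
Definition opp_idx i : 'Z_(n.*2) := i + n%:R.
Definition side_pt i (s : R) : 'rV[R]_2 := P i + s *: edge i.

(* Positively oriented convex polygon with parallel opposite sides.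
   The polygon lies to the left of each of its oriented sides; injectivity
   excludes polygons that wind around several times. *)
Definition cppos : Prop :=
  [/\ (1 < n)%N,
      injective P,
      forall i k, 0 <= det2 (edge i) (P k - P i),
      forall i, lin_indep (edge i) (edge (i + 1))
    & forall i, parallel (edge i) (edge (opp_idx i))].

Definition region : set 'rV[R]_2 :=
  [set z | exists2 a : 'Z_(n.*2) -> R,
     (forall k, 0 <= a k) /\ \sum_k a k = 1 & z = \sum_k a k *: P k].

Definition open_side i : set 'rV[R]_2 :=
  [set x | exists2 s : R, 0 < s < 1 & x = side_pt i s].

Definition boundary : set 'rV[R]_2 := \bigcup_i segment (P i) (P (i + 1)).

(* Boundary involution; the image of a point of [boundary] does not depend on
   the choice of [i] and [s]. *)
Definition sigma x : 'rV[R]_2 :=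
  get [set x' | exists i, exists2 s : R,
         0 <= s <= 1 & x = side_pt i s /\ x' = side_pt (opp_idx i) s].

(* Meant for lines [L] that meet the interior of [region]: these meet
   [boundary] in exactly two points. *)
Definition reflected_line L : set 'rV[R]_2 :=
  [set z | exists x y, [/\ L `&` boundary = [set x; y], x <> y
                         & line (sigma x) (sigma y) z]].

Definition pencil_line p (theta : R) : set 'rV[R]_2 :=
  line p (p + \row_(k < 2) [:: cos theta; sin theta]`_k).

Definition pencil p : set (set 'rV[R]_2) := range (pencil_line p).

(* [pencil_line p] has period [pi]. *)
Definition open_arc p (C : set (set 'rV[R]_2)) : Prop :=
  exists a b : R, [/\ a < b, b <= a + pi & C = pencil_line p @` `]a, b[].

Definition chord_ends i j L : Prop :=
  exists x y, [/\ open_side i x, open_side j y & L `&` boundary = [set x; y]].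

Definition cell_on p i j (C : set (set 'rV[R]_2)) : Prop :=
  [/\ open_arc p C, C `<=` chord_ends i j
    & forall A, open_arc p A -> A `<=` chord_ends i j -> C `<=` A -> A = C].

Definition cell p (C : set (set 'rV[R]_2)) : Prop := exists i j, cell_on p i j C.

Definition reflected_pencil p (theta : R) : set 'rV[R]_2 :=
  reflected_line (pencil_line p theta).

Definition cell_envelope p (C : set (set 'rV[R]_2)) : set 'rV[R]_2 :=
  [set z | exists2 theta, C (pencil_line p theta)
                        & envelope_pt (reflected_pencil p) theta (lift_pt z)].

(* One-sided envelope points at a cell transition are obtained by taking for
   [G] the left or right neighbourhoods of the transition angle. *)
Definition envelope_limit p (G : set_system R) z : Prop :=
  exists2 g : R -> 'rV[R]_2,
    (\forall theta \near G,
        envelope_pt (reflected_pencil p) theta (lift_pt (g theta)))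
    & g @ G --> z.

Definition transition_segment p k (T : set 'rV[R]_2) : Prop :=
  exists theta z1 z2,
    [/\ pencil_line p theta (P k),
        envelope_limit p theta^'- z1, envelope_limit p theta^'+ z2
      & T = segment z1 z2].

Definition ART p : set 'rV[R]_2 :=
  [set z | (exists2 C, cell p C & cell_envelope p C z)
        \/ (exists k, exists2 T, transition_segment p k T & T z)].

Definition no_line_through_two_vertices p : Prop :=
  forall L k k', pencil p L -> L (P k) -> L (P k') -> k = k'.

End Polygon.

(* Main.v *)
Require Import Defs.
From HB Require Import structures.
From mathcomp Require Import all_boot all_order all_algebra.
From mathcomp Require Import all_classical all_reals all_analysis.
From mathcomp Require Import ring lra.
Import Order.TTheory GRing.Theory Num.Theory.
Import numFieldNormedType.Exports.
Set Implicit Arguments.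
Unset Strict Implicit.
Unset Printing Implicit Defensive.
Local Open Scope classical_set_scope.
Local Open Scope card_scope.
Local Open Scope ring_scope.

(** Fix a line through p in the direction d, and call [det2 (P k - p) d] the
    offset of the vertex k.  Everything about the chord is read off from the
    signs of the offsets.  Since p lies strictly to the left of every side, the
    line leaves P through the open sides i and j exactly when i and j are
    distinct and the offsets change sign along each of them ([chord_endsP]),
    and the crossing parameter on a side is a quotient of offsets.  For
    d = side_pt i s - p this quotient is the Moebius function t(s) of the
    statement, and the reflected line becomes a quadratic curve of line
    coordinates ([refl_coordsE], [refl_line_coords]).

    The envelope of a quadratic curve l of lines is l x l', where the cubic
    terms cancel ([cross_qcurve]).  Neither another choice of line coordinates
    nor another parameter of the pencil changes the point: if l = c m, then
    differentiating l x m = 0 gives l x l' = c^2 (m x m') without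
    differentiating c ([cross_derive_proportional], [envelope_ptP]).  A
    quadratic curve spans the space, and is then a conic in suitable
    coordinates, or else stays in a plane and degenerates ([param_conicP]).

    The envelope point is never at infinity, because the reflected chord always
    turns in the same sense: when the original line turns about p, both ends of
    the chord run round P in the same sense, hence so do their images.  In
    formulas, the third coordinate of the envelope point is a sum of two terms
    that measure how far each end of the reflected chord lies inside the side
    that carries the other end ([envelope_curve_third],
    [envelope_curve_third_gt0]).  So all parameters of a cell are regular, and
    the inequality persists at a line through a single vertex, where it makes
    the one-sided limits exist ([envelope_limit_crosses]).

    For the count, write P k - p = rho k (cos (phi k), sin (phi k)) with
    0 <= phi k < pi.  In general position the phi k are distinct and cut the
    circle of directions modulo pi into 2n arcs, one beginning at each vertex
    direction.  On such an arc the offset rho m sin (theta - phi m) of every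
    vertex m has a constant sign, so the two sides that are met are constant;
    and no larger arc qualifies, because a line through a vertex has no chord
    with both ends in open sides.  Hence the cells are these arcs
    ([cell_is_vertex_cell], [vertex_cell_inj]).  The parameter s is a monotone
    function of the angle, so each cell carries one arc of its conic
    ([vertex_cell_params]), and the two arcs adjacent to a vertex line supply
    the one-sided limits of the transition at that vertex. *)

(** * Plane and homogeneous coordinates *)

Section Plane.
Variable R : realType.
Implicit Types (u v x y z : 'rV[R]_2) (w l m : 'rV[R]_3).

Lemma rowP2 u v : u 0 0 = v 0 0 -> u 0 1 = v 0 1 -> u = v.
Proof.
move=> h0 h1; apply/rowP => -[[|[|//]] lt2].
  by rewrite (_ : Ordinal lt2 = 0) //; apply/val_inj.
by rewrite (_ : Ordinal lt2 = 1) //; apply/val_inj.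
Qed.

Lemma rowP3 w l : w 0 0 = l 0 0 -> w 0 1 = l 0 1 -> w 0 2%:R = l 0 2%:R ->
  w = l.
Proof.
move=> h0 h1 h2; apply/rowP => -[[|[|[|//]]] lt3].
- by rewrite (_ : Ordinal lt3 = 0) //; apply/val_inj.
- by rewrite (_ : Ordinal lt3 = 1) //; apply/val_inj.
- by rewrite (_ : Ordinal lt3 = 2%:R) //; apply/val_inj.
Qed.

Lemma big_ord3 (V : nmodType) (F : 'I_3 -> V) : \sum_i F i = F 0 + F 1 + F 2%:R.
Proof.
rewrite !big_ord_recl big_ord0 addr0 addrA.
by congr (F _ + F _ + F _); apply/val_inj.
Qed.

Lemma det2E u v : det2 u v = u 0 0 * v 0 1 - u 0 1 * v 0 0.
Proof.
have E0 k : (col_mx u v : 'M[R]_2) 0 k = u 0 k.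
  by rewrite -(col_mxEu u v 0 k); congr (_ _ k); apply/val_inj.
have E1 k : (col_mx u v : 'M[R]_2) 1 k = v 0 k.
  by rewrite -(col_mxEd u v 0 k); congr (_ _ k); apply/val_inj.
rewrite /det2 (expand_det_row _ 0) !big_ord_recl big_ord0 addr0 /cofactor.
rewrite !det_mx11 ![_ (row' _ _) _ _]mxE ![_ (col' _ _) _ _]mxE.
rewrite (_ : lift 0 0 = 1 :> 'I_2); last exact/val_inj.
rewrite (_ : lift 1 0 = 0 :> 'I_2); last exact/val_inj.
by rewrite !E0 !E1 /= expr0 expr1 mul1r mulN1r mulrN.
Qed.

Lemma lift_ptE x : (lift_pt x 0 0 = x 0 0) * (lift_pt x 0 1 = x 0 1)
  * (lift_pt x 0 2%:R = 1).
Proof.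
rewrite /lift_pt; do !split; rewrite mxE; case: splitP => //= j e; rewrite ?mxE //.
- by rewrite (_ : j = 0) //; apply/val_inj; rewrite /= -e.
- by rewrite (_ : j = 1) //; apply/val_inj; rewrite /= -e.
- by case: j e => -[|[]].
Qed.

Lemma lift_vecE x : (lift_vec x 0 0 = x 0 0) * (lift_vec x 0 1 = x 0 1)
  * (lift_vec x 0 2%:R = 0).
Proof.
rewrite /lift_vec; do !split; rewrite mxE; case: splitP => //= j e; rewrite ?mxE //.
- by rewrite (_ : j = 0) //; apply/val_inj; rewrite /= -e.
- by rewrite (_ : j = 1) //; apply/val_inj; rewrite /= -e.
- by case: j e => -[|[]].
Qed.

Lemma crossE w l :
  (cross w l 0 0 = w 0 1 * l 0 2%:R - w 0 2%:R * l 0 1) *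
  (cross w l 0 1 = w 0 2%:R * l 0 0 - w 0 0 * l 0 2%:R) *
  (cross w l 0 2%:R = w 0 0 * l 0 1 - w 0 1 * l 0 0).
Proof. by rewrite !mxE. Qed.

Lemma incidenceE w l : (w *m l^T = 0) <->
  w 0 0 * l 0 0 + w 0 1 * l 0 1 + w 0 2%:R * l 0 2%:R = 0.
Proof.
have E : (w *m l^T) 0 0 = w 0 0 * l 0 0 + w 0 1 * l 0 1 + w 0 2%:R * l 0 2%:R.
  by rewrite mxE big_ord3 !mxE.
rewrite -E; split => [->|h]; first by rewrite mxE.
by apply/rowP => k; rewrite ord1 h mxE.
Qed.

Definition dir (theta : R) : 'rV[R]_2 := \row_(k < 2) [:: cos theta; sin theta]`_k.

Lemma dirE t : (dir t 0 0 = cos t) * (dir t 0 1 = sin t).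
Proof. by rewrite !mxE. Qed.

Lemma det2Dr u v x : det2 u (v + x) = det2 u v + det2 u x.
Proof. by rewrite !det2E !mxE; ring. Qed.

Lemma det20 u : det2 u 0 = 0.
Proof. by rewrite !det2E !mxE; ring. Qed.

Lemma det2Zl a u v : det2 (a *: u) v = a * det2 u v.
Proof. by rewrite !det2E !mxE; ring. Qed.

Lemma det2Zr a u v : det2 u (a *: v) = a * det2 u v.
Proof. by rewrite !det2E !mxE; ring. Qed.

Lemma det2Nr u v : det2 u (- v) = - det2 u v.
Proof. by rewrite !det2E !mxE; ring. Qed.

Lemma det2C u v : det2 u v = - det2 v u.
Proof. by rewrite !det2E; ring. Qed.

Lemma det2vv u : det2 u u = 0.
Proof. by rewrite !det2E; ring. Qed.

(** The three-term Pluecker relation. It turns differences of products of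
    offsets, which arise whenever crossing parameters are compared or
    differentiated, into products whose signs are known. *)
Lemma det2_plucker (a b c d : 'rV[R]_2) :
  det2 a b * det2 c d = det2 a c * det2 b d - det2 a d * det2 b c.
Proof. by rewrite !det2E; ring. Qed.

Lemma det2_eq0P u v : u != 0 -> det2 u v = 0 -> exists k, v = k *: u.
Proof.
move=> u0; rewrite det2E => h.
have [u00|u00] := eqVneq (u 0 0) 0.
  have u01 : u 0 1 != 0.
    by apply: contraNneq u0 => u01; apply/eqP/rowP2; rewrite !mxE.
  exists (v 0 1 / u 0 1); apply/rowP2; rewrite !mxE; last by field.
  move: h; rewrite u00 mul0r sub0r mulr0 => /eqP.
  by rewrite oppr_eq0 mulf_eq0 (negPf u01) => /eqP.
exists (v 0 0 / u 0 0); apply/rowP2; rewrite !mxE; first by field.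
apply: (mulfI u00); apply/eqP; rewrite -subr_eq0; apply/eqP.
by rewrite -h; field.
Qed.

Lemma exists_det2_lt0 u : u != 0 -> exists v, det2 u v < 0.
Proof.
move=> u0; exists (\row_(k < 2) [:: u 0 1; - u 0 0]`_k).
rewrite det2E !mxE /= mulrN -opprD oppr_lt0 lt_neqAle -!expr2.
rewrite addr_ge0 ?sqr_ge0 // andbT eq_sym paddr_eq0 ?sqr_ge0 // !sqrf_eq0.
apply: contraNN u0 => /andP[/eqP e0 /eqP e1].
by apply/eqP/rowP2; rewrite mxE.
Qed.

Lemma lineP x y z : x != y -> line x y z <-> det2 (y - x) (z - x) = 0.
Proof.
move=> xy; split=> [[t ->]|].
  by rewrite (addrC x) addrK det2Zr det2vv mulr0.
have yx : y - x != 0 by rewrite subr_eq0 eq_sym.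
by move=> /(det2_eq0P yx)[k e]; exists k; rewrite -e addrC subrK.
Qed.

Lemma line_same x y y' : x != y -> x != y' -> line x y y' -> line x y = line x y'.
Proof.
move=> xy xy' [t e].
have t0 : t != 0.
  by apply: contraNneq xy' => t0; rewrite e t0 scale0r addr0.
have e' : y' - x = t *: (y - x) by rewrite e (addrC x) addrK.
apply/seteqP; split=> z [k ->].
  by exists (k / t); rewrite e' scalerA divfK.
by exists (k * t); rewrite e' scalerA.
Qed.

Lemma lineC x y : line x y = line y x.
Proof.
by apply/seteqP; split=> z [k ->]; exists (1 - k); apply/rowP2; rewrite !mxE; ring.
Qed.

Lemma line_coords_cross k x y : k != 0 -> x != y ->
  line_coords (k *: cross (lift_pt x) (lift_pt y)) (line x y).
Proof.
move=> k0 xy; split.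
  apply: contraNneq xy => /eqP; rewrite scaler_eq0 (negPf k0) /= => /eqP e.
  have := congr1 (fun w : 'rV_3 => w 0 0) e.
  have := congr1 (fun w : 'rV_3 => w 0 1) e.
  rewrite !crossE !lift_ptE ![(0 : 'rV_3) _ _]mxE => e1 e0.
  by apply/eqP/rowP2; apply/eqP; rewrite -subr_eq0; apply/eqP; lra.
apply/seteqP; split=> z /=;
  rewrite incidenceE (lineP _ xy) det2E ![_ (k *: _) _ _]mxE !crossE !lift_ptE !mxE.
  by move=> h; rewrite -[RHS](mulr0 k) -h; ring.
by move=> h; apply: (mulfI k0); rewrite mulr0 -h; ring.
Qed.

(** Two points of the line determine its coordinates up to a factor. The line
    at infinity is also covered: its affine trace is empty, and a vector with
    empty trace is a multiple of (0, 0, 1). *)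
Lemma line_coords_unique l m A : line_coords l A -> line_coords m A ->
  exists2 c, c != 0 & m = c *: l.
Proof.
have aux l' m' : l' 0 0 ^+ 2 + l' 0 1 ^+ 2 != 0 -> line_coords l' A ->
    line_coords m' A -> exists2 c, c != 0 & m' = c *: l'.
  set a := l' 0 0; set b := l' 0 1; set c := l' 0 2%:R; set q := _ + _.
  move=> q0 [_ Al] [m0 Am].
  (* z 0 is the foot of the perpendicular from the origin to the line, and
     t moves along the line. *)
  pose z (t : R) : 'rV[R]_2 := \row_(k < 2) [:: - c / q * a - t * b; - c / q * b + t * a]`_k.
  have mz t : m' 0 0 * z t 0 0 + m' 0 1 * z t 0 1 + m' 0 2%:R = 0.
    have : A (z t).
      rewrite Al /= incidenceE !lift_ptE !mxE /= -/a -/b -/c; rewrite /q in q0 *.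
      by field.
    by rewrite Am /= incidenceE !lift_ptE => <-; ring.
  have := mz 0; have := mz 1; rewrite !mxE /= => h1 h0.
  have e : m' = ((m' 0 0 * a + m' 0 1 * b) / q) *: l'.
    have h : m' 0 1 * a = m' 0 0 * b.
      by apply/eqP; rewrite -subr_eq0 -[X in _ == X](subrr (0 : R)) -{1}h1 -h0; apply/eqP; ring.
    apply/rowP3; rewrite !mxE -/a -/b -/c; apply: (mulIf q0).
    - rewrite mulrAC divfK // /q; ring: h.
    - rewrite mulrAC divfK // /q; ring: h.
    - rewrite mulrAC divfK //; apply/eqP; rewrite -subr_eq0; apply/eqP.
      rewrite -[RHS](mulr0 q) -h0; field.
      exact: q0.
  exists ((m' 0 0 * a + m' 0 1 * b) / q) => //.
  by apply: contraNneq m0 => k0; rewrite e k0 scale0r.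
have sq w : w 0 0 ^+ 2 + w 0 1 ^+ 2 = 0 -> w 0 0 = 0 /\ w 0 1 = 0.
  move=> /eqP; rewrite paddr_eq0 ?sqr_ge0 // !expf_eq0 /=.
  by move=> /andP[/eqP -> /eqP ->].
move=> hl hm.
have [/sq[l0 l1]|ln] := eqVneq (l 0 0 ^+ 2 + l 0 1 ^+ 2) 0; last exact: aux.
have [/sq[m0 m1]|mn] := eqVneq (m 0 0 ^+ 2 + m 0 1 ^+ 2) 0; last first.
  have [c c0 ->] := aux _ _ mn hm hl.
  by exists c^-1; rewrite ?invr_eq0 // scalerA mulVf // scale1r.
have nz w A' : line_coords w A' -> w 0 0 = 0 -> w 0 1 = 0 -> w 0 2%:R != 0.
  move=> [w0 _] w00 w01; apply: contraNneq w0 => w02.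
  by apply/eqP/rowP3; rewrite mxE.
have l2 := nz _ _ hl l0 l1; have m2 := nz _ _ hm m0 m1.
exists (m 0 2%:R / l 0 2%:R); first by rewrite mulf_neq0 ?invr_eq0.
by apply/rowP3; rewrite !mxE ?l0 ?l1 ?m0 ?m1 ?mulr0 // divfK.
Qed.

Lemma same_pointZ a w l : a != 0 -> same_point (a *: w) l <-> same_point w l.
Proof.
move=> a0; split=> -[w0 [c c0 ->]]; split.
- by move: w0; rewrite scaler_eq0 (negPf a0).
- by exists (c * a); rewrite ?mulf_neq0 // scalerA.
- by rewrite scaler_eq0 (negPf a0).
- by exists (c / a); rewrite ?mulf_neq0 ?invr_eq0 // scalerA divfK.
Qed.

Lemma affineE w : (affine w 0 0 = w 0 0 / w 0 2%:R) * (affine w 0 1 = w 0 1 / w 0 2%:R).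
Proof.
by split; rewrite /affine !mxE mulrC; congr (w _ _ / _); apply/val_inj.
Qed.

Lemma same_point_affine w z : w 0 2%:R != 0 ->
  same_point w (lift_pt z) <-> z = affine w.
Proof.
move=> w2; split=> [[_ [c c0 e]]|->].
  have e0 := congr1 (fun w : 'rV_3 => w 0 0) e.
  have e1 := congr1 (fun w : 'rV_3 => w 0 1) e.
  have e2 := congr1 (fun w : 'rV_3 => w 0 2%:R) e.
  move: e0 e1 e2; rewrite !lift_ptE !mxE => e0 e1 e2.
  have ec : c = (w 0 2%:R)^-1 by apply: (mulIf w2); rewrite -e2 mulVf.
  by apply/rowP2; rewrite affineE ?e0 ?e1 ec mulrC.
split; first by apply: contraNneq w2 => ->; rewrite mxE.
exists (w 0 2%:R)^-1; first by rewrite invr_eq0.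
by apply/rowP3; rewrite !lift_ptE ?affineE [RHS]mxE ?mulVf // mulrC.
Qed.

(** When c0, c1, c2 form a basis, the curve has coordinates (1, s, s^2) and
    lies on the conic with equation x0 x2 = x1^2, whose only further point is
    (0, 0, 1), the value at infinity. Otherwise some nonzero linear form kills
    all three vectors. *)
Lemma param_conicP (c0 c1 c2 : 'rV[R]_3) :
  param_conic c0 c1 c2 \/ param_degenerate_conic c0 c1 c2.
Proof.
pose M : 'M[R]_3 := \matrix_(i < 3) [:: c0; c1; c2]`_i.
have sumM (x : 'rV_3) : x *m M = x 0 0 *: c0 + x 0 1 *: c1 + x 0 2%:R *: c2.
  by rewrite mulmx_sum_row big_ord3 !rowK.
have qE s : qcurve c0 c1 c2 s = (\row_(k < 3) s ^+ k) *m M.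
  by rewrite sumM !mxE expr0 scale1r expr1.
have [/eqP|detM] := eqVneq (\det M) 0.
  rewrite -det_tr => /det0P[v v0 vM]; right; exists v => // s.
  by rewrite qE -[LHS]trmxK trmx_mul trmxK (trmx_mul _ M) mulmxA vM mul0mx trmx0.
left.
(* K (-2) is the Gram matrix of 2 x0 x2 - 2 x1 ^+ 2; its inverse is again of
   the form K b. *)
pose K (b : R) : 'M[R]_3 := \matrix_(i < 3) [:: \row_(k < 3) [:: 0; 0; 1]`_k;
   \row_(k < 3) [:: 0; b; 0]`_k; \row_(k < 3) [:: 1; 0; 0]`_k]`_i.
have unitM : M \in unitmx by rewrite unitmxE unitfE.
exists (invmx M *m K (-2) *m (invmx M)^T).
have KE (b : R) (x : 'rV_3) :
    x *m K b = \row_(k < 3) [:: x 0 2%:R; b * x 0 1; x 0 0]`_k.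
  rewrite mulmx_sum_row big_ord3 !rowK /=.
  by apply/rowP3; rewrite !mxE /=; ring.
have detK : \det (K (-2)) != 0.
  rewrite -unitfE -unitmxE.
  suff : K (-2) *m K (- 2^-1) = 1%:M by case/mulmx1_unit.
  apply/row_matrixP => i; rewrite row_mul KE row1; apply/rowP3;
    by case: i => -[|[|[|//]]] lt; rewrite !mxE /= ?mulr0 // ?mulNr ?mulrN ?opprK ?mulr1 ?mulVf.
split.
- rewrite !trmx_mul trmxK mulmxA; congr (_ *m _ *m _); apply/matrixP.
  by move=> -[[|[|[|//]]] ?] [[|[|[|//]]] ?]; rewrite !mxE /= ?mxE.
- by rewrite !det_mulmx det_tr det_inv !mulf_neq0 ?invr_eq0.
move=> w w0.
have [x xE] : exists x : 'rV_3, x = w *m invmx M by exists (w *m invmx M).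
have wx : w = x 0 0 *: c0 + x 0 1 *: c1 + x 0 2%:R *: c2 by rewrite -sumM xE mulmxKV.
have c2E : c2 = (\row_(k < 3) [:: 0; 0; 1]`_k) *m M.
  by rewrite sumM !mxE /= !scale0r !add0r scale1r.
have nz (u : 'rV_3) : u != 0 -> u *m M != 0.
  by apply: contraNneq => h; rewrite -(mulmxK unitM u) h mul0mx.
rewrite !mulmxA -xE -mulmxA -trmx_mul -xE KE incidenceE !mxE /=; split.
  move=> h.
  have [x0|x0] := eqVneq (x 0 0) 0.
    left; split.
      by rewrite c2E nz //; apply/eqP => /(congr1 (fun x : 'rV_3 => x 0 2%:R)); rewrite !mxE /=; apply/eqP/oner_neq0.
    have x1 : x 0 1 = 0.
      apply/eqP; rewrite -sqrf_eq0; apply/eqP; rewrite x0 in h; lra.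
    exists (x 0 2%:R); last by rewrite wx x0 x1 !scale0r !add0r.
    by apply: contraNneq w0 => x2; rewrite wx x0 x1 x2 !scale0r !add0r.
  right; exists (x 0 1 / x 0 0); split.
    by rewrite qE nz //; apply/eqP => /(congr1 (fun x : 'rV_3 => x 0 0)); rewrite !mxE /= expr0; apply/eqP/oner_neq0.
  exists (x 0 0) => //; rewrite wx /qcurve !scalerDr !scalerA; congr (_ + _ *: _ + _ *: _).
    by field.
  have -> : x 0 2%:R = x 0 1 ^+ 2 / x 0 0 by apply: (mulIf x0); rewrite divfK //; lra.
  by field.
have xP (u : 'rV_3) : u *m M = w -> x = u by move=> uw; rewrite xE -uw mulmxK.
move=> [[_ [c cn /esym]]|[s [_ [c cn /esym]]]].
  by rewrite c2E scalemxAl => /xP ->; rewrite !mxE /=; ring.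
by rewrite qE scalemxAl => /xP ->; rewrite !mxE /= expr0 expr1; ring.
Qed.

End Plane.

(** * Envelopes of quadratic families of lines *)

Section Envelope.
Variable R : realType.
Implicit Types (l m : R -> 'rV[R]_3) (w : 'rV[R]_3).

Lemma derive1_row l s k : derivable l s 1 ->
  derivable (fun r => l r 0 k) s 1 /\
  derive1 l s 0 k = 'D_1 (fun r => l r 0 k) s.
Proof.
move=> dl; split; first by move/derivable_mxP : dl; exact.
by rewrite derive1E derive_mx // mxE.
Qed.

(** The factor between two choices of coordinates need not be known to be
    differentiable. It suffices to differentiate l x m = 0: at s this gives
    l' x m = - l x m', and substituting l = c m turns both sides into
    multiples of m x m'. *)
Lemma cross_derive_proportional l m s : derivable l s 1 -> derivable m s 1 ->
  (\forall r \near s, exists2 c, c != 0 & l r = c *: m r) ->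
  exists2 c, c != 0 &
    cross (l s) (derive1 l s) = c *: cross (m s) (derive1 m s).
Proof.
move=> dl dm lm.
have [c c0 ls] := nbhs_singleton lm.
(* The derivatives of the 2 x 2 minors of l and m, which vanish near s. *)
have minor a b : derive1 l s 0 a * m s 0 b + l s 0 a * derive1 m s 0 b
    - (derive1 l s 0 b * m s 0 a + l s 0 b * derive1 m s 0 a) = 0.
  have [la ->] := derive1_row a dl; have [lb ->] := derive1_row b dl.
  have [ma ->] := derive1_row a dm; have [mb ->] := derive1_row b dm.
  have dla := derivableP la; have dlb := derivableP lb.
  have dma := derivableP ma; have dmb := derivableP mb.
  have d := @derive_val _ _ _ _ _ _ _
    (is_deriveB (is_deriveM dla dmb) (is_deriveM dlb dma)).
  rewrite (near_eq_derive (g := cst 0)) in d; last first.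
    near=> r.
    have [k k0 e] : exists2 k, k != 0 & l r = k *: m r by near: r.
    by rewrite !fctE /= e !mxE; ring.
  by rewrite derive_cst /GRing.scale /= in d; rewrite d; ring.
exists (c * c); first by rewrite mulf_neq0.
have minor' a b : l s 0 a * derive1 l s 0 b - l s 0 b * derive1 l s 0 a =
    c * c * (m s 0 a * derive1 m s 0 b - m s 0 b * derive1 m s 0 a).
  have := minor a b; rewrite ls !mxE => h.
  have {}h : m s 0 a * derive1 l s 0 b - m s 0 b * derive1 l s 0 a =
    c * (m s 0 a * derive1 m s 0 b - m s 0 b * derive1 m s 0 a).
    by apply/eqP; rewrite -subr_eq0 -oppr_eq0 -[X in _ == X]h; apply/eqP; ring.
  by rewrite -[in RHS]mulrA -h; ring.
by apply/rowP3; rewrite crossE minor' [RHS]mxE crossE.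
Unshelve. all: by end_near. Qed.

Lemma qcurve_derive (l0 l1 l2 : 'rV[R]_3) (h : R -> R) r : derivable h r 1 ->
  derivable (fun x => qcurve l0 l1 l2 (h x)) r 1 /\
  derive1 (fun x => qcurve l0 l1 l2 (h x)) r =
    derive1 h r *: (l1 + (2 * h r) *: l2).
Proof.
move=> dh.
have D k : is_derive r 1 (fun x => qcurve l0 l1 l2 (h x) 0 k)
    (derive1 h r * (l1 0 k + 2 * h r * l2 0 k)).
  have dh' := derivableP dh.
  have -> : (fun x => qcurve l0 l1 l2 (h x) 0 k) =
      cst (l0 0 k) + h * cst (l1 0 k) + (h ^+ 2) * cst (l2 0 k).
    by apply/funext => x; rewrite /qcurve !mxE.
  apply: is_derive_eq; rewrite derive1E /GRing.scale /= !fctE /=.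
  ring.
have dq : derivable (fun x => qcurve l0 l1 l2 (h x)) r 1.
  by apply/derivable_mxP => i j; rewrite ord1; apply: (@ex_derive _ _ _ _ _ _ _ (D j)).
split=> //; apply/rowP => k; rewrite (derive1_row k dq).2.
by rewrite (@derive_val _ _ _ _ _ _ _ (D k)) !mxE.
Qed.

(** The cross product of a quadratic curve with its derivative has formal
    degree 3, but the coefficient of s^3 is 2 (l2 x l2) = 0. *)
Lemma cross_qcurve (l0 l1 l2 : 'rV[R]_3) s :
  cross (qcurve l0 l1 l2 s) (l1 + (2 * s) *: l2) =
  qcurve (cross l0 l1) (2 *: cross l0 l2) (cross l1 l2) s.
Proof.
rewrite /qcurve; apply/rowP3; rewrite !mxE /= ?mxE; ring.
Qed.

Lemma crossZr (a : R) w (w' : 'rV[R]_3) : cross w (a *: w') = a *: cross w w'.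
Proof. by apply/rowP3; rewrite !mxE /= ?mxE; ring. Qed.

(** The function h is a change of parameter. Allowing it makes the same lemma
    serve the parameter on a side (h = id) and the angle of the pencil. *)
Lemma envelope_ptP (l0 l1 l2 : 'rV[R]_3) (F : R -> set 'rV[R]_2) (h : R -> R) r
    (Z := qcurve (cross l0 l1) (2 *: cross l0 l2) (cross l1 l2) (h r)) :
  derivable h r 1 -> derive1 h r != 0 -> Z != 0 ->
  (\forall x \near r, line_coords (qcurve l0 l1 l2 (h x)) (F x)) ->
  forall w, envelope_pt F r w <-> same_point Z w.
Proof.
move=> dh h0 Z0 lc w.
have [dq qE] := qcurve_derive l0 l1 l2 dh.
have crossq : cross (qcurve l0 l1 l2 (h r))
    (derive1 (fun x => qcurve l0 l1 l2 (h x)) r) = derive1 h r *: Z.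
  by rewrite qE crossZr cross_qcurve.
split=> [[l [lcl dl _]]|sZ].
  have [|c c0] := cross_derive_proportional dl dq.
    near=> x; apply: (@line_coords_unique _ _ _ (F x)); by near: x.
  by rewrite crossq scalerA => -> /same_pointZ; apply; rewrite mulf_neq0.
exists (fun x => qcurve l0 l1 l2 (h x)); split=> //; rewrite crossq.
  by rewrite scaler_eq0 negb_or h0.
exact/same_pointZ.
Unshelve. all: by end_near. Qed.

Lemma envelope_pt_unique F s (z z' : 'rV[R]_2) :
  envelope_pt F s (lift_pt z) -> envelope_pt F s (lift_pt z') -> z = z'.
Proof.
move=> [l [lc dl n0 [w0 [c c0 e]]]] [l' [lc' dl' n0' [w0' [c' c0' e']]]].
have [|k k0 E] := cross_derive_proportional dl dl'.
  near=> x; apply: (@line_coords_unique _ _ _ (F x)); by near: x.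
have e'' : lift_pt z = (c * k / c') *: lift_pt z'.
  by rewrite e E e' !scalerA divfK.
have eE k' : lift_pt z 0 k' = c * k / c' * lift_pt z' 0 k' by rewrite e'' mxE.
move: (eE 0) (eE 1) (eE 2%:R); rewrite !lift_ptE mulr1 => e0 e1 e2.
by apply/rowP2; rewrite ?e0 ?e1 -e2 mul1r.
Unshelve. all: by end_near. Qed.

End Envelope.

(** * Convex polygons with parallel opposite sides *)

Section Polygon.
Variables (R : realType) (n : nat) (P : 'Z_(n.*2) -> 'rV[R]_2).
Implicit Types (i j k : 'Z_(n.*2)) (x y z p d : 'rV[R]_2).

Lemma lin_indepE (u v : 'rV[R]_2) : lin_indep u v = (det2 u v != 0).
Proof. by rewrite /lin_indep row_free_unit unitmxE unitfE. Qed.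

(** Successive steps from a reach every index of the cycle. *)
Lemma cyclic_switch (g : pred 'Z_(n.*2)) a b :
  g a -> ~~ g b -> exists i, g i && ~~ g (i + 1).
Proof.
move=> ga; apply: contraNP => H.
have step m : g (a + m%:R).
  elim: m => [|m IH]; first by rewrite addr0.
  rewrite mulrSr addrA; apply/negPn/negP => h.
  by apply: H; exists (a + m%:R); rewrite IH.
by have := step (b - a)%R; rewrite natr_Zp addrC subrK.
Qed.

Lemma side_pt0 i : side_pt P i 0 = P i.
Proof. by rewrite /side_pt scale0r addr0. Qed.

Lemma boundaryP x : boundary P x <-> exists i, exists2 s, 0 <= s <= 1 & x = side_pt P i s.
Proof.
split=> [[i _ [s s01 ->]]|[i [s s01 ->]]]; first by exists i, s.
by exists i => //; exists s.
Qed.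

Lemma boundary_side i s : 0 <= s <= 1 -> boundary P (side_pt P i s).
Proof. by move=> h; apply/boundaryP; exists i, s. Qed.

Hypothesis hP : cppos P.

Let injP : injective P. Proof. by case: hP. Qed.
Let convP i k : 0 <= det2 (edge P i) (P k - P i). Proof. by case: hP. Qed.

Lemma cppos_two_neq0 : 2%:R != 0 :> 'Z_(n.*2).
Proof.
have [n1 _ _ _ _] := hP.
have n2 : (2 < n.*2)%N by rewrite (ltn_double 1).
apply/eqP => h; have := congr1 (@nat_of_ord _) h.
by rewrite val_Zp_nat ?modn_small // (ltn_trans _ n2).
Qed.

Lemma opp_idx_inj : injective (@opp_idx n).
Proof. by move=> i j; apply: addIr. Qed.

Lemma edge_neq0 i : edge P i != 0.
Proof.
apply/eqP => /eqP; rewrite subr_eq0 => /eqP/injP/eqP.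
by rewrite -subr_eq0 addrC addKr oner_eq0.
Qed.

(** The polygon lies to the left of both edges at the middle vertex, so these
    edges must be parallel to the line through the three vertices. Consecutive
    edges are not parallel. *)
Lemma no_middle_vertex m a b v t u : v != 0 ->
  P a - P m = t *: v -> P b - P m = u *: v -> t * u < 0 -> False.
Proof.
move=> v0 ha hb tu.
have z (q : R) : 0 <= t * q -> 0 <= u * q -> q = 0.
  move=> h1 h2; apply/eqP; rewrite -sqrf_eq0 eq_le sqr_ge0 andbT.
  by rewrite -(nmulr_rge0 _ tu) expr2 mulrACA mulr_ge0.
have e1 : det2 (edge P m) v = 0.
  by apply: z; rewrite -det2Zr -?ha -?hb.
have E c : P c - P m = (P c - P (m - 1)) - edge P (m - 1).
  by rewrite /edge subrK opprB addrA subrK.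
have e2 : det2 (edge P (m - 1)) v = 0.
  by apply: z; rewrite -det2Zr -?ha -?hb E det2Dr det2Nr det2vv subr0.
have [_ _ _ /(_ (m - 1)) + _] := hP; rewrite subrK lin_indepE => /eqP; apply.
have [c ->] : exists c, edge P (m - 1) = c *: v.
  by apply: det2_eq0P => //; rewrite det2C e2 oppr0.
by rewrite det2Zl det2C e1 oppr0 mulr0.
Qed.

(** Three vertices on one line would have one of them between the other two. *)
Lemma vertex_off_side i k : k != i -> k != i + 1 -> 0 < det2 (edge P i) (P k - P i).
Proof.
move=> ki ki1; rewrite lt_neqAle convP andbT; apply/eqP => /esym h.
have [t ht] := det2_eq0P (edge_neq0 i) h.
have e1 : P (i + 1) - P i = 1 *: edge P i by rewrite scale1r.
have t0 : t != 0.
  apply: contraNneq ki => t0; apply/eqP/injP/eqP.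
  by rewrite -subr_eq0 ht t0 scale0r.
have t1 : t != 1.
  by apply: contraNneq ki1 => t1; apply/eqP/injP/(addIr (- P i)); rewrite ht t1 e1.
have no := @no_middle_vertex _ _ _ _ _ _ (edge_neq0 i).
have [tn|tp|/eqP] := ltgtP t 0; last by rewrite (negPf t0).
  by apply: (no _ _ _ _ _ ht e1); rewrite mulr1.
have ei : P i - P (i + 1) = (-1) *: edge P i by rewrite scaleN1r opprB.
have [tn1|tp1|/eqP] := ltgtP t 1; last by rewrite (negPf t1).
  apply: (no k i (i + 1) (- t) (1 - t)).
  - by rewrite scaleNr -ht opprB.
  - by rewrite scalerBl -ht scale1r opprB addrA subrK.
  - nra.
apply: (no (i + 1) i k (- 1) (t - 1)) => //; last by nra.
by rewrite scalerBl -ht -e1 opprB addrA subrK.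
Qed.

Lemma det2_side i j s : det2 (edge P j) (side_pt P i s - P j) =
  (1 - s) * det2 (edge P j) (P i - P j) + s * det2 (edge P j) (P (i + 1) - P j).
Proof. by rewrite /side_pt /edge !det2E !mxE; ring. Qed.

Lemma det2_side_ge0 i j s : 0 <= s <= 1 ->
  0 <= det2 (edge P j) (side_pt P i s - P j).
Proof.
move=> /andP[s0 s1]; rewrite det2_side.
by rewrite addr_ge0 // mulr_ge0 // subr_ge0.
Qed.

Lemma det2_side_gt0 i j s : i != j -> 0 < s < 1 ->
  0 < det2 (edge P j) (side_pt P i s - P j).
Proof.
move=> ij /andP[s0 s1]; rewrite det2_side.
have [e|ij1] := eqVneq i (j + 1).
  apply: ltr_wpDl; first by rewrite mulr_ge0 // subr_ge0 ltW.
  rewrite mulr_gt0 // vertex_off_side // e.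
    by rewrite -addrA -{2}(addr0 j) (inj_eq (addrI j)) cppos_two_neq0.
  by rewrite -{2}(addr0 (j + 1)) (inj_eq (addrI _)) oner_eq0.
apply: ltr_wpDr; first by rewrite mulr_ge0 // ltW.
by rewrite mulr_gt0 ?subr_gt0 // vertex_off_side.
Qed.

Lemma det2_side_self i s : det2 (edge P i) (side_pt P i s - P i) = 0.
Proof. by rewrite /side_pt addrC addKr det2Zr det2vv mulr0. Qed.

Lemma side_pt_inj i : injective (side_pt P i).
Proof.
move=> s t /addrI/eqP; rewrite -subr_eq0 -scalerBl scaler_eq0.
by rewrite (negPf (edge_neq0 i)) orbF subr_eq0 => /eqP.
Qed.

(** Another side line has the points of an open side strictly on its left. *)
Lemma open_side_inj i j s t : 0 < s < 1 -> side_pt P i s = side_pt P j t ->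
  i = j /\ s = t.
Proof.
move=> s01 e; have [ij|ij] := eqVneq i j.
  by split => //; apply: (@side_pt_inj i); rewrite e ij.
by have := det2_side_gt0 ij s01; rewrite e det2_side_self ltxx.
Qed.

Lemma sigma_side i s : 0 < s < 1 -> sigma P (side_pt P i s) = side_pt P (opp_idx i) s.
Proof.
move=> s01; rewrite /sigma.
set A := [set x' | _].
have A0 : exists x, A x.
  exists (side_pt P (opp_idx i) s), i, s => //.
  by case/andP: s01 => ? ?; rewrite !ltW.
have [j [t _ [e ->]]] := getPex A0.
by have [-> ->] := open_side_inj s01 e.
Qed.

Lemma boundary_det2_ge0 x j : boundary P x -> 0 <= det2 (edge P j) (x - P j).
Proof. by move=> /boundaryP[i [s s01 ->]]; apply: det2_side_ge0. Qed.

Lemma region_det2_ge0 x j : region P x -> 0 <= det2 (edge P j) (x - P j).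
Proof.
move=> [a [a0 a1] ->].
have -> : \sum_k a k *: P k - P j = \sum_k a k *: (P k - P j).
  rewrite -{1}(scale1r (P j)) -a1 scaler_suml -sumrB.
  by apply: eq_bigr => k _; rewrite scalerBr.
rewrite (big_morph _ (det2Dr (edge P j)) (det20 (edge P j))).
by apply: sumr_ge0 => k _; rewrite det2Zr mulr_ge0.
Qed.

(** A point with value 0 could be moved slightly across the line of side j
    without leaving the region. *)
Lemma interior_det2_gt0 p j : interior (region P) p -> 0 < det2 (edge P j) (p - P j).
Proof.
move=> hp.
have [v ev] := exists_det2_lt0 (edge_neq0 j).
have cv : (fun t : R => p + t *: v) @ 0^'+ --> p.
  rewrite -[X in _ --> X](addr0 p) -(scale0r v); apply: cvgD; first exact: cvg_cst.
  apply: cvgZr_tmp; apply: cvg_at_right_filter; exact: cvg_id.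
have reg : \forall t \near (0:R)^'+, region P (p + t *: v) by exact: (cv _ hp).
near (0 : R)^'+ => t.
have t0 : 0 < t by [].
have /region_det2_ge0 - /(_ j) : region P (p + t *: v) by near: t.
rewrite (_ : p + t *: v - P j = (p - P j) + t *: v); last by rewrite addrAC.
by rewrite det2Dr det2Zr => h; nra.
Unshelve. all: by end_near. Qed.

End Polygon.

(** * Lines through an inner point *)

Section Chords.
Variables (R : realType) (n : nat) (P : 'Z_(n.*2) -> 'rV[R]_2) (p : 'rV[R]_2).
Implicit Types (i j k : 'Z_(n.*2)) (x y z d : 'rV[R]_2).

Definition vertex_offset d k := det2 (P k - p) d.
Notation offset := vertex_offset.

Definition crosses_sides d i j := [&& i != j, offset d i * offset d (i + 1) < 0
  & offset d j * offset d (j + 1) < 0].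

Notation crosses := crosses_sides.

Definition crossing_param d i := offset d i / (offset d i - offset d (i + 1)).
Notation crossing_par := crossing_param.

Lemma offset_edge d i : offset d (i + 1) - offset d i = det2 (edge P i) d.
Proof. by rewrite /vertex_offset /edge !det2E !mxE; ring. Qed.

Lemma offset_side d i s : det2 (side_pt P i s - p) d =
  (1 - s) * offset d i + s * offset d (i + 1).
Proof. by rewrite /vertex_offset /side_pt /edge !det2E !mxE; ring. Qed.

Lemma offsetZ c d k : offset (c *: d) k = c * offset d k.
Proof. exact: det2Zr. Qed.

Lemma crossing_parZ c d i : c != 0 -> crossing_par (c *: d) i = crossing_par d i.
Proof.
by move=> c0; rewrite /crossing_param !offsetZ -mulrBr invfM mulrACA divff // mul1r.
Qed.

Lemma crossesZ c d i j : c != 0 -> crosses (c *: d) i j = crosses d i j.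
Proof.
move=> c0; rewrite /crosses_sides !offsetZ.
have E (a b : R) : (c * a * (c * b) < 0) = (a * b < 0).
  by rewrite mulrACA pmulr_rlt0 // -expr2 exprn_even_gt0.
by rewrite !E.
Qed.

Lemma prod_lt0_neq (a b : R) : a * b < 0 -> a != b.
Proof. by apply: contraTneq => ->; rewrite -leNgt -expr2 sqr_ge0. Qed.

Lemma crossing_par_itv d i : offset d i * offset d (i + 1) < 0 ->
  0 < crossing_par d i < 1.
Proof.
rewrite /crossing_param; set a := offset d i; set b := offset d (i + 1) => h.
have ab : a - b != 0 by rewrite subr_eq0 prod_lt0_neq.
have ab2 : 0 < (a - b) ^+ 2 by rewrite exprn_even_gt0.
have -> : a / (a - b) = a * (a - b) / (a - b) ^+ 2 by field.
by rewrite divr_gt0 ?ltr_pdivrMr //; nra.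
Qed.

Lemma crossing_on_line d i : offset d i != offset d (i + 1) ->
  det2 (side_pt P i (crossing_par d i) - p) d = 0.
Proof.
by rewrite -subr_eq0 => h; rewrite offset_side /crossing_param; field.
Qed.

Lemma crossing_par_unique d i s : offset d i != offset d (i + 1) ->
  det2 (side_pt P i s - p) d = 0 -> s = crossing_par d i.
Proof.
rewrite -subr_eq0 offset_side => h e; apply: (mulIf h).
by rewrite divfK //; apply/eqP; rewrite -subr_eq0 -oppr_eq0 -[X in _ == X]e; apply/eqP; ring.
Qed.

Hypothesis hP : cppos P.
Hypothesis hin : forall j, 0 < det2 (edge P j) (p - P j).

Lemma boundary_neq x : boundary P x -> x != p.
Proof.
move=> /boundaryP[i [s s01 ->]]; apply/eqP => e.
by have := hin i; rewrite -e det2_side_self ltxx.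
Qed.

(** Going outwards along a ray from p, the first boundary point lies on some
    side line, and all later points of the ray lie strictly to the right of it. *)
Lemma ray_boundary_unique x y (k : R) : boundary P x -> boundary P y ->
  0 < k -> y - p = k *: (x - p) -> x = y.
Proof.
have aux x' y' (k' : R) : boundary P x' -> boundary P y' -> 1 < k' -> y' - p <> k' *: (x' - p).
  move=> /boundaryP[i [s s01 ex]] by' k1 e.
  have := boundary_det2_ge0 hP i by'.
  have -> : y' - P i = (p - P i) + k' *: ((x' - P i) - (p - P i)).
    have -> : (x' - P i) - (p - P i) = x' - p by rewrite opprB addrA subrK.
    by rewrite -e [RHS]addrC addrA subrK.
  rewrite det2Dr det2Zr (det2Dr _ (x' - P i)) det2Nr {1}ex det2_side_self.
  by have := hin i; nra.
move=> bx by_ k0 e; have [k1|k1|k1] := ltgtP k 1.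
- have [] := aux _ _ k^-1 by_ bx; first by rewrite invf_gt1.
  by rewrite e scalerA mulVf ?gt_eqF // scale1r.
- by have := aux _ _ _ bx by_ k1.
- by apply: (addIr (- p)); rewrite e k1 scale1r.
Qed.

(** Each of the two rays from p carries at most one boundary point, so x and y
    lie on opposite rays and there is no third point. *)
Lemma line_boundary d x y : boundary P x -> boundary P y -> x != y ->
  line p (p + d) x -> line p (p + d) y -> line p (p + d) `&` boundary P = [set x; y].
Proof.
move=> bx by_ xy [t ex] [u ey].
have vE z v : z = p + v *: (p + d - p) -> z - p = v *: d.
  by move=> ->; rewrite addrAC subrr add0r (addrC p) addrK.
move/vE : ex => ex; move/vE : ey => ey.
have nz z v : boundary P z -> z - p = v *: d -> v != 0.
  move=> /boundary_neq zp e; apply: contraNneq zp => v0.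
  by rewrite -subr_eq0 e v0 scale0r.
have same z z' v v' : boundary P z -> boundary P z' -> z - p = v *: d ->
    z' - p = v' *: d -> 0 < v * v' -> z = z'.
  move=> bz bz' ez ez' vv'; have v0 := nz _ _ bz ez.
  apply: (@ray_boundary_unique _ _ (v' / v)) => //.
    rewrite (_ : v' / v = v * v' / v ^+ 2); last by field.
    by rewrite divr_gt0 // exprn_even_gt0.
  by rewrite ez ez' scalerA divfK.
have t0 := nz _ _ bx ex; have u0 := nz _ _ by_ ey.
have tu : t * u < 0.
  rewrite lt_neqAle mulf_neq0 //= leNgt; apply: contra xy => h.
  exact/eqP/(same _ _ _ _ bx by_ ex ey).
apply/seteqP; split=> z; last first.
  by move=> [] ->; split=> //; [exists t|exists u]; rewrite (addrC p d) addrK -(ex, ey) addrC subrK.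
move=> [[v /vE ez] bz]; have v0 := nz _ _ bz ez.
have [vt|vt] := ltP 0 (v * t); first by left; apply: (same _ _ _ _ bz bx ez ex).
right; apply: (same _ _ _ _ bz by_ ez ey).
have {vt} : v * t < 0 by rewrite lt_neqAle mulf_neq0.
move=> vt; have t2 : 0 < t ^+ 2 by rewrite exprn_even_gt0.
by rewrite -(pmulr_rgt0 _ t2) expr2 mulrACA (mulrC t v) nmulr_rgt0.
Qed.

End Chords.

(** * Chords and reflected lines *)

Section ChordEnds.
Variables (R : realType) (n : nat) (P : 'Z_(n.*2) -> 'rV[R]_2) (p : 'rV[R]_2).
Implicit Types (i j k : 'Z_(n.*2)) (x y z d : 'rV[R]_2).
Notation offset := (vertex_offset P p).
Notation crosses := (crosses_sides P p).
Notation crossing_par := (crossing_param P p).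

Hypothesis hP : cppos P.
Hypothesis hin : forall j, 0 < det2 (edge P j) (p - P j).

Lemma pencil_lineP d x : d != 0 -> line p (p + d) x <-> det2 (x - p) d = 0.
Proof.
move=> d0; rewrite lineP; last by rewrite -subr_eq0 opprD addNKr oppr_eq0.
rewrite (addrC p) addrK det2C; split=> [/eqP|->]; last by rewrite oppr0.
by rewrite oppr_eq0 => /eqP.
Qed.

Lemma crosses_dir_neq0 d i j : crosses d i j -> d != 0.
Proof.
move=> /and3P[_ + _]; apply: contraTneq => ->.
by rewrite /vertex_offset !det20 mul0r ltxx.
Qed.

Lemma crossing_boundary d i : d != 0 -> offset d i * offset d (i + 1) < 0 ->
  line p (p + d) (side_pt P i (crossing_par d i)) /\
  boundary P (side_pt P i (crossing_par d i)).
Proof.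
move=> d0 h; split.
  by apply/pencil_lineP => //; apply: crossing_on_line; exact: prod_lt0_neq h.
have /andP[? ?] := crossing_par_itv h.
by apply: boundary_side; rewrite !ltW.
Qed.

Lemma crosses_chord d i j : crosses d i j -> line p (p + d) `&` boundary P =
  [set side_pt P i (crossing_par d i); side_pt P j (crossing_par d j)].
Proof.
move=> c; have d0 := crosses_dir_neq0 c; case/and3P: c => ij hi hj.
have [li bi] := crossing_boundary d0 hi; have [lj bj] := crossing_boundary d0 hj.
apply: line_boundary => //; apply: contraNneq ij => e.
by apply/eqP; have [] := open_side_inj hP (crossing_par_itv hi) e.
Qed.

(** Otherwise p would lie on the line of the side i. *)
Lemma vertices_of_side_offset d i : d != 0 -> offset d i = 0 -> offset d (i + 1) != 0.
Proof.
move=> d0; rewrite /vertex_offset !(det2C _ d) => /eqP; rewrite oppr_eq0 => /eqP/(det2_eq0P d0)[a ea].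
rewrite oppr_eq0; apply/eqP => /(det2_eq0P d0)[b eb].
have := hin i.
have -> : edge P i = (P (i + 1) - p) - (P i - p) by rewrite /edge opprB addrA subrK.
have -> : p - P i = - (P i - p) by rewrite opprB.
by rewrite ea eb -scalerBl det2Nr det2Zl det2Zr det2vv !mulr0 oppr0 ltxx.
Qed.

Lemma chord_ends_offset d i j k : d != 0 ->
  chord_ends P i j (line p (p + d)) -> offset d k != 0.
Proof.
move=> d0 [x [y [[s s01 ex] [t t01 ey] L]]]; apply/eqP => h.
have : [set x; y] (P k).
  rewrite -L; split; first exact/pencil_lineP.
  by rewrite -(side_pt0 P k); apply: boundary_side; rewrite lexx ler01.
rewrite -(side_pt0 P k) ex ey => -[]/esym e.
  by have [_ s0] := open_side_inj hP s01 e; rewrite s0 ltxx in s01.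
by have [_ t0] := open_side_inj hP t01 e; rewrite t0 ltxx in t01.
Qed.

Lemma side_on_line d i s : offset d i != 0 -> 0 < s < 1 ->
  det2 (side_pt P i s - p) d = 0 -> offset d i * offset d (i + 1) < 0.
Proof.
move=> f0 /andP[s0 s1]; rewrite offset_side => e.
rewrite -(pmulr_rlt0 _ s0).
have -> : s * (offset d i * offset d (i + 1)) = - ((1 - s) * offset d i ^+ 2).
  by apply/eqP; rewrite -subr_eq0 -[X in _ == X](mulr0 (offset d i)) -e; apply/eqP; ring.
by rewrite oppr_lt0 mulr_gt0 ?subr_gt0 // exprn_even_gt0.
Qed.

(** Beyond side i, the vertices have to come back across the line. *)
Lemma other_crossing d i : offset d i * offset d (i + 1) < 0 ->
  exists2 j, j != i & exists2 s, 0 <= s <= 1 & det2 (side_pt P j s - p) d = 0.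
Proof.
move=> h.
wlog fi : d h / 0 < offset d i.
  move=> W; have [fi|fi|fi] := ltgtP 0 (offset d i); first exact: W.
    have [||j ji [s s01 e]] := W ((-1) *: d).
    - by rewrite !offsetZ mulrACA mulrNN !mul1r.
    - by rewrite offsetZ mulN1r oppr_gt0.
    by exists j => //; exists s => //; move/eqP: e; rewrite det2Zr mulN1r oppr_eq0 => /eqP.
  by rewrite -fi mul0r ltxx in h.
have fi1 : offset d (i + 1) < 0 by rewrite pmulr_rlt0 in h.
have [|j /andP[j1]] := @cyclic_switch n (fun k => offset d k < 0) (i + 1) i fi1.
  by rewrite -leNgt ltW.
rewrite -leNgt => j2; exists j; first by apply: contraTneq j1 => ->; rewrite -leNgt ltW.
have jn : offset d j != offset d (j + 1) by rewrite lt_eqF // (lt_le_trans j1).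
exists (crossing_par d j); last exact: crossing_on_line.
have q : offset d j - offset d (j + 1) < 0 by rewrite subr_lt0 (lt_le_trans j1).
by rewrite /crossing_param ler_ndivlMr // ler_ndivrMr // mul0r mul1r; apply/andP; split; lra.
Qed.

(** If both ends were on the same side, they would coincide, and the second
    boundary point supplied by [other_crossing] would be missing from the
    chord. *)
Lemma chord_endsP d i j : d != 0 -> chord_ends P i j (line p (p + d)) <-> crosses d i j.
Proof.
move=> d0; split=> [ce|c].
  have f0 k := chord_ends_offset k d0 ce.
  have [x [y [[s s01 ex] [t t01 ey] L]]] := ce.
  have [/(pencil_lineP _ d0) lx bx] : (line p (p + d) `&` boundary P) x.
    by rewrite L; left.
  have [/(pencil_lineP _ d0) ly by_] : (line p (p + d) `&` boundary P) y.
    by rewrite L; right.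
  rewrite ex in lx; rewrite ey in ly.
  have ci := side_on_line (f0 i) s01 lx.
  have cj := side_on_line (f0 j) t01 ly.
  apply/and3P; split=> //; apply/eqP => ij; subst j.
  have st : s = t.
    have fi := prod_lt0_neq ci.
    by rewrite (crossing_par_unique fi lx) (crossing_par_unique fi ly).
  have [k ki [u u01 lk]] := other_crossing ci.
  have : [set x; y] (side_pt P k u).
    by rewrite -L; split; [exact/pencil_lineP|exact: boundary_side].
  have -> : y = x by rewrite ex ey st.
  move=> h; have {h} : side_pt P k u = x by case: h.
  rewrite ex => /esym /(open_side_inj hP s01)[ik _].
  by rewrite ik eqxx in ki.
have /and3P[_ hi hj] := c.
exists (side_pt P i (crossing_par d i)), (side_pt P j (crossing_par d j)).
split; last exact: crosses_chord.
  by exists (crossing_par d i) => //; exact: crossing_par_itv.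
by exists (crossing_par d j) => //; exact: crossing_par_itv.
Qed.

(** As p is a convex combination of the vertices, the offsets have a weighted
    mean 0, so both signs occur. Going round the polygon they
    change from positive to negative somewhere, and back elsewhere. *)
Lemma exists_crosses d : region P p -> (forall k, offset d k != 0) -> exists i j, crosses d i j.
Proof.
move=> [a [a0 a1] pE] f0.
have sum0 : \sum_k a k * offset d k = 0.
  have -> : \sum_k a k * offset d k = det2 (\sum_k a k *: P k - p) d.
    rewrite -[X in _ - X]scale1r -a1 scaler_suml -sumrB det2C.
    rewrite (big_morph _ (det2Dr d) (det20 d)) -sumrN.
    by apply: eq_bigr => k _; rewrite -scalerBr -det2C det2Zl.
  by rewrite -pE subrr det2C det20 oppr0.
have sgn (e : R) : e != 0 -> exists k, 0 < e * offset d k.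
  move=> e0; apply: contrapT => /forallNP neg.
  have le0 k : e * offset d k <= 0 by rewrite leNgt; apply/negP/neg.
  have a_eq0 k : a k = 0.
    have s0 : \sum_k a k * (- (e * offset d k)) = 0.
      by under eq_bigr do rewrite mulrN mulrCA; rewrite sumrN -mulr_sumr sum0 mulr0 oppr0.
    have ak l : true -> 0 <= a l * - (e * offset d l).
      by move=> _; rewrite mulr_ge0 ?oppr_ge0.
    have /eqP := psumr_eq0P ak s0 (i := k) isT.
    by rewrite mulf_eq0 oppr_eq0 mulf_eq0 (negPf e0) (negPf (f0 k)) !orbF => /eqP.
  by move/eqP: a1; rewrite big1 => [|k _]; rewrite ?a_eq0 // eq_sym oner_eq0.
have [k] := sgn 1 (oner_neq0 _); rewrite mul1r => fk.
have m1 : -1 != 0 :> R by rewrite oppr_eq0 oner_eq0.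
have [l] := sgn _ m1; rewrite mulN1r oppr_gt0 => fl.
have nl0 m : ~~ (0 < offset d m) = (offset d m < 0).
  by rewrite -leNgt le_eqVlt (negPf (f0 m)).
have nl0' m : ~~ (offset d m < 0) = (0 < offset d m).
  by rewrite -leNgt le_eqVlt eq_sym (negPf (f0 m)).
have [|i /andP[i1]] := @cyclic_switch n (fun k => 0 < offset d k) k l fk.
  by rewrite nl0.
rewrite nl0 => i2.
have [|j /andP[j1]] := @cyclic_switch n (fun k => offset d k < 0) l k fl.
  by rewrite nl0'.
rewrite nl0' => j2.
exists i, j; apply/and3P; split; [|by rewrite pmulr_rlt0|by rewrite nmulr_rlt0].
by apply: contraTneq j1 => <-; rewrite -leNgt ltW.
Qed.

Lemma reflected_neq i j s t : i != j -> 0 < s < 1 ->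
  side_pt P (opp_idx i) s != side_pt P (opp_idx j) t.
Proof.
move=> ij s01; apply: contraNneq ij => e.
by have [/opp_idx_inj ->] := open_side_inj hP s01 e.
Qed.

(** The two ends of the chord may be listed in either order, but both orders
    give the same reflected line. *)
Lemma reflected_lineE d i j : crosses d i j -> reflected_line P (line p (p + d)) =
  line (side_pt P (opp_idx i) (crossing_par d i)) (side_pt P (opp_idx j) (crossing_par d j)).
Proof.
move=> c; have L := crosses_chord c.
have /and3P[ij /crossing_par_itv hi /crossing_par_itv hj] := c.
rewrite -(sigma_side hP i hi) -(sigma_side hP j hj).
set x := side_pt P i _ in L *; set y := side_pt P j _ in L *.
have xy : x <> y by move=> /(open_side_inj hP hi)[/eqP]; rewrite (negPf ij).
apply/seteqP; split=> z; last by exists x, y.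
rewrite /reflected_line L /= => -[x' [y' [e xy' lz]]].
have [ex|ex] : [set x; y] x' by rewrite e; left.
  have [ey|<-] : [set x; y] y' by rewrite e; right.
    by rewrite ex ey in xy'.
  by rewrite -ex.
have [<-|ey] : [set x; y] y' by rewrite e; right.
  by rewrite -ex lineC.
by rewrite ex ey in xy'.
Qed.

End ChordEnds.

(** * Coordinates and envelope of the reflected lines *)

Section Reflected.
Variables (R : realType) (n : nat) (P : 'Z_(n.*2) -> 'rV[R]_2) (p : 'rV[R]_2).
Implicit Types (i j k : 'Z_(n.*2)) (x y z d : 'rV[R]_2).
Notation offset := (vertex_offset P p).
Notation crosses := (crosses_sides P p).
Notation crossing_par := (crossing_param P p).

Definition coefD0 i j := det2 (P i - p) (edge P j).
Definition coefD1 i j := det2 (edge P i) (edge P j).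
Definition coefN0 i j := - det2 (P i - p) (P j - p).
Definition coefN1 i j := - det2 (edge P i) (P j - p).
Definition refl_u0 i := lift_pt (P (opp_idx i)).
Definition refl_u1 i := lift_vec (edge P (opp_idx i)).
Definition refl_v0 i j := coefD0 i j *: lift_pt (P (opp_idx j))
  + coefN0 i j *: lift_vec (edge P (opp_idx j)).
Definition refl_v1 i j := coefD1 i j *: lift_pt (P (opp_idx j))
  + coefN1 i j *: lift_vec (edge P (opp_idx j)).
Definition refl_l0 i j := cross (refl_u0 i) (refl_v0 i j).
Definition refl_l1 i j := cross (refl_u0 i) (refl_v1 i j) + cross (refl_u1 i) (refl_v0 i j).
Definition refl_l2 i j := cross (refl_u1 i) (refl_v1 i j).
Definition refl_coords i j := qcurve (refl_l0 i j) (refl_l1 i j) (refl_l2 i j).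
Definition envelope_curve i j := qcurve (cross (refl_l0 i j) (refl_l1 i j))
  (2 *: cross (refl_l0 i j) (refl_l2 i j)) (cross (refl_l1 i j) (refl_l2 i j)).

Lemma cross_bilinear (u0 u1 v0 v1 : 'rV[R]_3) (s : R) :
  cross (u0 + s *: u1) (v0 + s *: v1) =
  qcurve (cross u0 v0) (cross u0 v1 + cross u1 v0) (cross u1 v1) s.
Proof. by rewrite /qcurve; apply/rowP3; rewrite !mxE /= ?mxE; ring. Qed.

Lemma lift_side k s : lift_pt (P k) + s *: lift_vec (edge P k) = lift_pt (side_pt P k s).
Proof.
apply/rowP3; rewrite [LHS]mxE [X in _ + X]mxE !lift_ptE !lift_vecE ?mulr0 ?addr0 //;
  by rewrite [RHS]mxE [X in _ = _ + X]mxE.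
Qed.

(** The vector v0 + s v1 is D(s) times the lift of the second image point.
    Clearing the denominator in this way is what makes the coordinates
    quadratic in s. *)
Lemma refl_coordsE i j s (D := coefD0 i j + s * coefD1 i j) : D != 0 ->
  refl_coords i j s = D *: cross (lift_pt (side_pt P (opp_idx i) s))
    (lift_pt (side_pt P (opp_idx j) ((coefN0 i j + s * coefN1 i j) / D))).
Proof.
move=> D0; rewrite /refl_coords -cross_bilinear lift_side -crossZr; congr (cross _ _).
rewrite -lift_side (scalerDr D) (scalerA D) (mulrC D) divfK // /refl_v0 /refl_v1 /D.
by apply/rowP3; rewrite !mxE; ring.
Qed.

Definition chord_dir i s := side_pt P i s - p.

Lemma offset_chord_dir i s k :
  offset (chord_dir i s) k = offset (P i - p) k + s * offset (edge P i) k.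
Proof. by rewrite /vertex_offset /chord_dir /side_pt !det2E !mxE; ring. Qed.

Lemma offset_chord_dirN i j s :
  offset (chord_dir i s) j = coefN0 i j + s * coefN1 i j.
Proof. by rewrite /vertex_offset /chord_dir /side_pt /coefN0 /coefN1 !det2E !mxE; ring. Qed.

Lemma offset_chord_dirD i j s :
  offset (chord_dir i s) j - offset (chord_dir i s) (j + 1) = coefD0 i j + s * coefD1 i j.
Proof.
rewrite /vertex_offset /chord_dir /side_pt /coefD0 /coefD1 /edge !det2E !mxE; ring.
Qed.

Lemma crossing_par_chord_dir i j s : crossing_par (chord_dir i s) j =
  (coefN0 i j + s * coefN1 i j) / (coefD0 i j + s * coefD1 i j).
Proof. by rewrite /crossing_param offset_chord_dirD offset_chord_dirN. Qed.

Lemma line_chord_dir i s : line p (p + chord_dir i s) = line p (side_pt P i s).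
Proof. by rewrite /chord_dir addrCA subrr addr0. Qed.

Hypothesis hP : cppos P.
Hypothesis hin : forall j, 0 < det2 (edge P j) (p - P j).

Lemma chord_dir_neq0 i s : 0 <= s <= 1 -> chord_dir i s != 0.
Proof.
by move=> s01; rewrite subr_eq0; apply: (boundary_neq hin); apply: boundary_side.
Qed.

Lemma crossing_par_chord_dir_self i s : crossing_par (chord_dir i s) i = s.
Proof.
apply/esym/crossing_par_unique; last exact: det2vv.
rewrite -subr_eq0 -opprB offset_edge oppr_eq0.
suff -> : det2 (edge P i) (chord_dir i s) = - det2 (edge P i) (p - P i).
  by rewrite oppr_eq0 gt_eqF.
by rewrite /chord_dir /side_pt !det2E !mxE; ring.
Qed.

Lemma crossing_par_collinear d i s : d != 0 -> 0 <= s <= 1 ->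
  det2 (chord_dir i s) d = 0 -> exists2 c, c != 0 & chord_dir i s = c *: d.
Proof.
move=> d0 s01; rewrite det2C => /eqP; rewrite oppr_eq0 => /eqP/(det2_eq0P d0)[c e].
exists c => //; have := chord_dir_neq0 i s01; rewrite e.
by apply: contraNneq => ->; rewrite scale0r.
Qed.

(** This passes from an arbitrary direction of the line to the direction from p
    to the crossing point on side i, for which the parameter s is explicit. *)
Lemma crosses_chord_dir d i j (s := crossing_par d i) : crosses d i j ->
  [/\ 0 < s < 1, line p (p + d) = line p (side_pt P i s) & crosses (chord_dir i s) i j].
Proof.
move=> c; have d0 := crosses_dir_neq0 c; have /and3P[ij hi hj] := c.
have s01 := crossing_par_itv hi.
have s01' : 0 <= s <= 1 by case/andP: s01 => ? ?; rewrite !ltW.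
have [k k0 e] := crossing_par_collinear d0 s01' (crossing_on_line (prod_lt0_neq hi)).
split=> //; last by rewrite e crossesZ.
rewrite -line_chord_dir e; apply: line_same.
- by rewrite -subr_eq0 opprD addNKr oppr_eq0.
- by rewrite -subr_eq0 opprD addNKr oppr_eq0 scaler_eq0 negb_or k0.
- by exists k; rewrite (addrC p d) addrK.
Qed.

Lemma refl_line_coords i j s : crosses (chord_dir i s) i j ->
  line_coords (refl_coords i j s) (reflected_line P (line p (side_pt P i s))).
Proof.
move=> c; have /and3P[ij /crossing_par_itv hi hj] := c.
rewrite -line_chord_dir (reflected_lineE hP hin c).
rewrite crossing_par_chord_dir_self crossing_par_chord_dir.
have D0 : coefD0 i j + s * coefD1 i j != 0.
  by rewrite -offset_chord_dirD subr_eq0 prod_lt0_neq.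
rewrite refl_coordsE //; apply: line_coords_cross => //.
by apply: reflected_neq => //; rewrite crossing_par_chord_dir_self in hi.
Qed.

Lemma envelope_curve_third_aux (A e B f : 'rV[R]_2) (D0 D1 N0 N1 s : R)
    (v0 := D0 *: lift_pt B + N0 *: lift_vec f) (v1 := D1 *: lift_pt B + N1 *: lift_vec f)
    (l0 := cross (lift_pt A) v0) (l1 := cross (lift_pt A) v1 + cross (lift_vec e) v0)
    (l2 := cross (lift_vec e) v1) :
  qcurve (cross l0 l1) (2 *: cross l0 l2) (cross l1 l2) s 0 2%:R =
  (N1 * D0 - N0 * D1) * det2 f (A + s *: e - B) + (D0 + s * D1) *
     ((D0 + s * D1) * det2 e (B - A) + (N0 + s * N1) * det2 e f).
Proof.
have v0E : (v0 0 0 = D0 * B 0 0 + N0 * f 0 0) * (v0 0 1 = D0 * B 0 1 + N0 * f 0 1)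
   * (v0 0 2%:R = D0).
  by rewrite /v0; do !split; rewrite mxE ![_ (_ *: _) _ _]mxE !lift_ptE !lift_vecE ?mulr0 ?mulr1 ?addr0.
have v1E : (v1 0 0 = D1 * B 0 0 + N1 * f 0 0) * (v1 0 1 = D1 * B 0 1 + N1 * f 0 1)
   * (v1 0 2%:R = D1).
  by rewrite /v1; do !split; rewrite mxE ![_ (_ *: _) _ _]mxE !lift_ptE !lift_vecE ?mulr0 ?mulr1 ?addr0.
move: v0 v1 v0E v1E @l0 @l1 @l2 => v0 v1 v0E v1E l0 l1 l2.
have addE (a b : 'rV[R]_3) (k : 'I_3) : (a + b) 0 k = a 0 k + b 0 k by rewrite mxE.
have sclE (c : R) (b : 'rV[R]_3) (k : 'I_3) : (c *: b) 0 k = c * b 0 k by rewrite mxE.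
rewrite /qcurve !(addE, sclE) !crossE /l1 !(addE, sclE) !crossE !lift_ptE !lift_vecE !v0E !v1E.
by rewrite !det2E !mxE; ring.
Qed.

(** Up to the factor D^2, the third coordinate is det (Y - X, Y' - X') for the
    image points X(s) and Y(t(s)), where X' = e_{i+n} and Y' = t' e_{j+n}. The
    derivative t' equals the product of the first two determinants divided by
    D^2. *)
Lemma envelope_curve_third i j s (D := coefD0 i j + s * coefD1 i j)
    (t := (coefN0 i j + s * coefN1 i j) / D) : D != 0 ->
  envelope_curve i j s 0 2%:R =
    det2 (edge P i) (p - P i) * det2 (edge P j) (p - P j) *
      det2 (edge P (opp_idx j)) (side_pt P (opp_idx i) s - P (opp_idx j)) +
    D ^+ 2 * det2 (edge P (opp_idx i)) (side_pt P (opp_idx j) t - P (opp_idx i)).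
Proof.
move=> D0; rewrite /envelope_curve envelope_curve_third_aux; congr (_ * _ + _).
  by rewrite /coefD0 /coefD1 /coefN0 /coefN1 /edge !det2E !mxE; ring.
rewrite -/D expr2 -mulrA; congr (_ * _).
rewrite (_ : side_pt _ _ t - _ = (P (opp_idx j) - P (opp_idx i)) + t *: edge P (opp_idx j)).
  by rewrite (det2Dr _ (_ - _)) det2Zr mulrDr mulrA /t (mulrC D (_ / D)) divfK.
by rewrite /side_pt addrAC.
Qed.

(** Both summands of [envelope_curve_third] are nonnegative. If one image point
    is interior to its side, it is strictly to the left of the line of the
    other side, and its summand is positive. *)
Lemma envelope_curve_third_gt0 i j s (D := coefD0 i j + s * coefD1 i j)
    (t := (coefN0 i j + s * coefN1 i j) / D) :
  i != j -> D != 0 -> 0 <= s <= 1 -> 0 <= t <= 1 -> (0 < s < 1) || (0 < t < 1) ->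
  0 < envelope_curve i j s 0 2%:R.
Proof.
move=> ij D0 s01 t01 st; rewrite envelope_curve_third // -/D -/t.
have D2 : 0 < D ^+ 2 by rewrite exprn_even_gt0.
have K0 : 0 < det2 (edge P i) (p - P i) * det2 (edge P j) (p - P j) by rewrite mulr_gt0.
have ij' : opp_idx i != opp_idx j by rewrite (inj_eq (@opp_idx_inj n)).
case/orP: st => h.
  apply: ltr_wpDr; first by apply: mulr_ge0; [exact: ltW|exact: det2_side_ge0].
  by rewrite mulr_gt0 // det2_side_gt0.
apply: ltr_wpDl; first by apply: mulr_ge0; [exact: ltW|exact: det2_side_ge0].
by rewrite mulr_gt0 // det2_side_gt0 // eq_sym.
Qed.

Lemma crosses_third_gt0 i j s : crosses (chord_dir i s) i j ->
  0 < envelope_curve i j s 0 2%:R.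
Proof.
move=> c; have /and3P[ij /crossing_par_itv hi hj] := c.
rewrite crossing_par_chord_dir_self in hi.
have := crossing_par_itv hj; rewrite crossing_par_chord_dir => tj.
apply: envelope_curve_third_gt0 => //.
- by rewrite -offset_chord_dirD subr_eq0 prod_lt0_neq.
- by case/andP: hi => ? ?; rewrite !ltW.
- by case/andP: tj => ? ?; rewrite !ltW.
- by rewrite hi.
Qed.

(** Sign changes of offsets are open conditions on the direction. *)
Lemma crosses_near (T : Type) (F : set_system T) {FF : Filter F}
    (d_ : T -> 'rV[R]_2) d i j :
  (forall k, offset (d_ x) k @[x --> F] --> offset d k) -> crosses d i j ->
  \forall x \near F, crosses (d_ x) i j.
Proof.
move=> cv /and3P[ij hi hj].
have L k : offset d k * offset d (k + 1) < 0 ->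
    \forall x \near F, offset (d_ x) k * offset (d_ x) (k + 1) < 0.
  by move=> h; apply: (cvgr_lt _ (cvgM (cv k) (cv (k + 1)))).
near=> x; apply/and3P; split=> //; near: x; exact: L.
Unshelve. all: by end_near. Qed.

Lemma crosses_chord_dir_near i j s : crosses (chord_dir i s) i j ->
  \forall r \near s, crosses (chord_dir i r) i j.
Proof.
move=> c; refine (@crosses_near _ (nbhs s) _ (chord_dir i) _ i j _ c) => k.
rewrite offset_chord_dir.
rewrite (_ : (fun r => _) = (fun r => offset (P i - p) k + r * offset (edge P i) k)).
  by apply: cvgD; [exact: cvg_cst|apply: cvgMr_tmp; exact: cvg_id].
by apply/funext => r; rewrite offset_chord_dir.
Qed.

Lemma offset_dir theta k :
  offset (dir theta) k = (P k - p) 0 0 * sin theta - (P k - p) 0 1 * cos theta.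
Proof. by rewrite /vertex_offset det2E !dirE. Qed.

Lemma offset_dir_cvg theta k : offset (dir x) k @[x --> theta] --> offset (dir theta) k.
Proof.
rewrite offset_dir (_ : (fun t => _) =
  (fun t => (P k - p) 0 0 * sin t - (P k - p) 0 1 * cos t)).
  by apply: cvgB; apply: cvgMl_tmp; [exact: continuous_sin|exact: continuous_cos].
by apply/funext => x; rewrite offset_dir.
Qed.

Lemma dir_neq0 (theta : R) : dir theta != 0.
Proof.
apply/eqP => e; have := cos2Dsin2 theta.
by rewrite -!dirE e !mxE expr0n addr0 => /esym/eqP; rewrite oner_eq0.
Qed.

Lemma crosses_dir_near (theta : R) i j : crosses (dir theta) i j ->
  \forall t \near theta, crosses (dir t) i j.
Proof.
move=> c; refine (@crosses_near _ (nbhs theta) _ (@dir R) _ i j _ c) => k.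
exact: offset_dir_cvg.
Qed.

Lemma offset_dir_derive (theta : R) k : is_derive theta 1 (fun t : R => offset (dir t) k)
  ((P k - p) 0 0 * cos theta + (P k - p) 0 1 * sin theta).
Proof.
rewrite (_ : (fun t => _) = cst ((P k - p) 0 0) * sin - cst ((P k - p) 0 1) * cos).
  by apply: is_derive_eq; rewrite /GRing.scale /= !mulr0 !addr0; ring.
by apply/funext => x; rewrite offset_dir.
Qed.

(** By the Pluecker relation the numerator of the derivative is
    det (P_i - p, P_{i+1} - p), which is positive because p is to the left of
    side i. *)
Lemma crossing_par_derive (theta : R) i :
  offset (dir theta) i != offset (dir theta) (i + 1) ->
  derivable (fun t : R => crossing_par (dir t) i) theta 1 /\
  derive1 (fun t : R => crossing_par (dir t) i) theta != 0.
Proof.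
set f := fun t : R => offset (dir t) i; set g := fun t : R => offset (dir t) (i + 1).
rewrite -subr_eq0 => fg.
have df := offset_dir_derive theta i; have dg := offset_dir_derive theta (i + 1).
have dfg := is_deriveB df dg.
have dV := derivableV (fg : (f - g) theta != 0) (@ex_derive _ _ _ _ _ _ _ dfg).
have D := is_deriveM df (DeriveDef dV (deriveV (fg : (f - g) theta != 0) (@ex_derive _ _ _ _ _ _ _ dfg))).
rewrite (@derive_val _ _ _ _ _ _ _ dfg) in D.
split; first exact: (@ex_derive _ _ _ _ _ _ _ D).
rewrite derive1E (@derive_val _ _ _ _ _ _ _ D) /GRing.scale /=.
have -> : (f - g) theta = offset (dir theta) i - offset (dir theta) (i + 1) by [].
set D2 := _ - offset _ _ in fg *.
have KE : det2 (edge P i) (p - P i) = (cos theta ^+ 2 + sin theta ^+ 2) *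
    ((P i - p) 0 0 * (P (i + 1) - p) 0 1 - (P i - p) 0 1 * (P (i + 1) - p) 0 0).
  by rewrite cos2Dsin2 mul1r /edge !det2E !mxE; ring.
suff -> : offset (dir theta) i * (- D2 ^- 2 *
   ((P i - p) 0 0 * cos theta + (P i - p) 0 1 * sin theta -
    ((P (i + 1) - p) 0 0 * cos theta + (P (i + 1) - p) 0 1 * sin theta))) +
  D2^-1 * ((P i - p) 0 0 * cos theta + (P i - p) 0 1 * sin theta) =
  det2 (edge P i) (p - P i) / D2 ^+ 2.
  by rewrite mulf_neq0 ?invr_eq0 ?expf_neq0 // gt_eqF.
rewrite KE; apply: (mulIf (expf_neq0 2 fg)); rewrite divfK ?expf_neq0 // /D2 !offset_dir.
rewrite /D2 !offset_dir in fg.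
by field.
Qed.

Lemma envelope_curveP (F : R -> set 'rV[R]_2) (h : R -> R) r i j :
  derivable h r 1 -> derive1 h r != 0 ->
  (\forall x \near r, line_coords (refl_coords i j (h x)) (F x)) ->
  crosses (chord_dir i (h r)) i j ->
  forall w, envelope_pt F r w <-> same_point (envelope_curve i j (h r)) w.
Proof.
move=> dh h0 nF c; apply: envelope_ptP => //.
have := crosses_third_gt0 c; rewrite -/(envelope_curve i j (h r)).
by apply: contraTneq => ->; rewrite mxE ltxx.
Qed.

Lemma envelope_side i j s : crosses (chord_dir i s) i j ->
  forall w, envelope_pt (fun r => reflected_line P (line p (side_pt P i r))) s w <->
    same_point (envelope_curve i j s) w.
Proof.
move=> c; apply: (@envelope_curveP _ id) => //.
  by rewrite derive1E derive_id oner_neq0.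
near=> r; apply: refl_line_coords; near: r; exact: crosses_chord_dir_near.
Unshelve. all: by end_near. Qed.

(** The angle and the parameter s are related by a local diffeomorphism, so
    they give the same envelope. *)
Lemma envelope_pencil (theta : R) i j z : crosses (dir theta) i j ->
  envelope_pt (reflected_pencil P p) theta (lift_pt z) <->
  z = affine (envelope_curve i j (crossing_par (dir theta) i)).
Proof.
move=> c; have [s01 lE c'] := crosses_chord_dir c.
have /and3P[_ hi _] := c.
have [dh h0] := crossing_par_derive (prod_lt0_neq hi).
have h := @envelope_curveP (reflected_pencil P p) _ theta i j dh h0 _ c'.
rewrite h; last first.
  near=> t.
  have ct : crosses (dir t) i j by near: t; exact: crosses_dir_near.
  have [_ lEt ct'] := crosses_chord_dir ct.
  have := refl_line_coords ct'; rewrite -lEt; exact.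
by rewrite same_point_affine // gt_eqF // crosses_third_gt0.
Unshelve. all: by end_near. Qed.

End Reflected.

(** * The parametrisation of one cell *)

Section Cell.
Variables (R : realType) (n : nat) (P : 'Z_(n.*2) -> 'rV[R]_2) (p : 'rV[R]_2).
Implicit Types (i j k : 'Z_(n.*2)) (x y z d : 'rV[R]_2) (s : R).
Notation offset := (vertex_offset P p).
Notation crosses := (crosses_sides P p).
Notation crossing_par := (crossing_param P p).
Notation refl_coords := (refl_coords P p).
Notation envelope_curve := (envelope_curve P p).
Notation chord_dir := (chord_dir P p).

Lemma cross_refl_coords_derive i j s :
  cross (refl_coords i j s) (derive1 (refl_coords i j) s) = envelope_curve i j s.
Proof.
have [|_ ->] := @qcurve_derive R (refl_l0 P p i j) (refl_l1 P p i j) (refl_l2 P p i j) id s.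
  exact: derivable_id.
by rewrite derive1E derive_id scale1r; exact: cross_qcurve.
Qed.

Hypothesis hP : cppos P.
Hypothesis hin : forall j, 0 < det2 (edge P j) (p - P j).

Variables (C : set (set 'rV[R]_2)) (i j : 'Z_(n.*2)).
Hypothesis Cpencil : C `<=` pencil p.
Hypothesis Cij : C `<=` chord_ends P i j.

Let S := [set s | 0 < s < 1 /\ C (line p (side_pt P i s))].

Lemma cell_crosses_dir theta : C (pencil_line p theta) -> crosses (dir theta) i j.
Proof.
move=> /Cij h; have := chord_endsP hP hin i j (dir_neq0 theta).
by move=> [+ _]; apply; exact: h.
Qed.

Lemma cell_crosses s : S s -> crosses (chord_dir i s) i j.
Proof.
move=> [s01 /Cij h].
have s01' : 0 <= s <= 1 by case/andP: s01 => ? ?; rewrite !ltW.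
have := chord_endsP hP hin i j (chord_dir_neq0 hin i s01').
by move=> [+ _]; apply; rewrite line_chord_dir.
Qed.

Lemma cell_dir_par theta (s := crossing_par (dir theta) i) :
  C (pencil_line p theta) -> S s /\ pencil_line p theta = line p (side_pt P i s).
Proof.
move=> Ct; have [s01 e _] := crosses_chord_dir hin (cell_crosses_dir Ct).
by split=> //; split=> //; rewrite -e.
Qed.

Lemma cell_image : C = (fun s => line p (side_pt P i s)) @` S.
Proof.
apply/seteqP; split=> [L CL|_ [s [_ Cs] <-] //].
have [theta _ e] := Cpencil CL; rewrite -e in CL.
have [Ss Le] := cell_dir_par CL.
by exists (crossing_par (dir theta) i) => //; rewrite -e Le.
Qed.

Lemma cell_envelopeE :
  cell_envelope P p C = [set affine (envelope_curve i j s) | s in S].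
Proof.
apply/seteqP; split=> z.
  move=> [theta Ct]; have c := cell_crosses_dir Ct.
  move=> /(envelope_pencil hP hin _ c) ->.
  by have [Ss _] := cell_dir_par Ct; exists (crossing_par (dir theta) i).
move=> [s Ss <-]; have [s01 Cs] := Ss.
have [theta _ e] := Cpencil Cs.
have Ct : C (pencil_line p theta) by rewrite e.
exists theta => //; apply/(envelope_pencil hP hin _ (cell_crosses_dir Ct)).
congr (affine (envelope_curve i j _)).
have c := cell_crosses_dir Ct; have /and3P[_ hi _] := c.
apply: crossing_par_unique; first exact: prod_lt0_neq.
apply/(pencil_lineP _ _ (dir_neq0 theta)).
rewrite (_ : line _ _ = line p (side_pt P i s)) //.
by exists 1; rewrite scale1r addrC subrK.
Qed.

End Cell.

(** * Pencils and angles *)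

Section Angles.
Variable R : realType.
Implicit Types (t u v a b theta : R) (x p : 'rV[R]_2).

Lemma det2_dir a b : det2 (dir a) (dir b) = sin (b - a).
Proof. by rewrite det2E !dirE sinB; ring. Qed.

Lemma pencil_lineE p theta : pencil_line p theta = line p (p + dir theta).
Proof. by []. Qed.

Lemma pencil_line_dirP p theta x : pencil_line p theta x <-> det2 (x - p) (dir theta) = 0.
Proof. exact: pencil_lineP (dir_neq0 theta). Qed.

Lemma pencil_line_eq p a b : sin (b - a) = 0 -> pencil_line p a = pencil_line p b.
Proof.
rewrite -det2_dir => /(det2_eq0P (dir_neq0 a))[k e].
have k0 : k != 0.
  by apply: contraNneq (dir_neq0 b) => k0; rewrite e k0 scale0r.
apply/seteqP; split=> x; rewrite !pencil_line_dirP e det2Zr.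
  by move=> ->; rewrite mulr0.
by move=> /eqP; rewrite mulf_eq0 (negPf k0) => /eqP.
Qed.

Lemma pencil_line_sin p a b : pencil_line p a = pencil_line p b -> sin (b - a) = 0.
Proof.
move=> e; have : pencil_line p b (p + dir a).
  by rewrite -e pencil_line_dirP addrAC subrr add0r det2vv.
by rewrite pencil_line_dirP addrAC subrr add0r det2_dir.
Qed.

Lemma sin_eq0_small t : - pi < t < pi -> sin t = 0 -> t = 0.
Proof.
move=> /andP[t1 t2] s0; have [tn|tp|//] := ltgtP t 0.
  have : 0 < sin (- t) by apply: sin_gt0_pi; rewrite oppr_gt0 tn ltrNl.
  by rewrite sinN s0 oppr0 ltxx.
have : 0 < sin t by apply: sin_gt0_pi; rewrite tp.
by rewrite s0 ltxx.
Qed.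

Lemma sin_intpi (z : int) : sin (z%:~R * pi : R) = 0.
Proof.
have N m : sin (m%:R * pi : R) = 0.
  elim: m => [|m IH]; first by rewrite mul0r sin0.
  by rewrite -natr1 mulrDl mul1r sinDpi IH oppr0.
case: z => m; first exact: N.
by rewrite NegzE mulrNz mulNr sinN (N m.+1) oppr0.
Qed.

(** Subtracting a suitable multiple of pi brings the angle into any half-open
    interval of length pi. *)
Lemma pencil_line_shift p a theta : exists delta, a <= theta + delta < a + pi /\
  forall t, pencil_line p (t + delta) = pencil_line p t.
Proof.
have pi0 := pi_gt0 R.
pose z := Num.floor ((theta - a) / pi).
exists (- (z%:~R * pi)); split.
  have := floor_itv ((theta - a) / pi); rewrite -/z.
  rewrite ler_pdivlMr // ltr_pdivrMr // intrD mulrDl mul1r => /andP[h1 h2].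
  by apply/andP; split; lra.
move=> t; apply: pencil_line_eq.
by rewrite (_ : t - (t - z%:~R * pi) = z%:~R * pi) ?sin_intpi //; ring.
Qed.

(** A line has an angle in [0, pi), at the price of a radius rho of either
    sign. For x off the first axis the angle is the arccotangent of
    x_0 / x_1. *)
Lemma polar_line x : x != 0 ->
  exists theta rho, [/\ 0 <= theta < pi, rho != 0 & x = rho *: dir theta].
Proof.
move=> x0; have pi0 := pi_gt0 R.
have [x1|x1] := eqVneq (x 0 1) 0.
  exists 0, (x 0 0); split; first by rewrite lexx.
    by apply: contraNneq x0 => x00; apply/eqP/rowP2; rewrite mxE.
  by apply/rowP2; rewrite [RHS]mxE dirE ?cos0 ?sin0 ?mulr1 ?mulr0.
(* pi / 2 - atan is the arccotangent, with values in ]0, pi[. *)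
pose b := atan (x 0 0 / x 0 1).
have b1 := atan_gtNpi2 (x 0 0 / x 0 1); have b2 := atan_ltpi2 (x 0 0 / x 0 1).
have cb : 0 < cos b by apply: cos_gt0_pihalf; rewrite b1.
exists (pi / 2 - b), (x 0 1 / cos b); split.
- by rewrite /b; apply/andP; split; lra.
- by rewrite mulf_neq0 ?invr_eq0 // gt_eqF.
have tb : sin b = cos b * (x 0 0 / x 0 1).
  by rewrite -[x 0 0 / x 0 1]atanK -/b /tan mulrC divfK // gt_eqF.
have cb0 : cos b != 0 by rewrite gt_eqF.
have dE : (dir (pi / 2 - b) 0 0 = sin b) * (dir (pi / 2 - b) 0 1 = cos b).
  by rewrite !dirE cosB sinB sin_pihalf cos_pihalf !mul0r !mul1r add0r subr0.
apply/rowP2; rewrite [RHS]mxE dE ?divfK // tb; field.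
by rewrite x1.
Qed.

End Angles.

(** * The cells of a pencil in general position *)

Section Cells.
Variables (R : realType) (n : nat) (P : 'Z_(n.*2) -> 'rV[R]_2) (p : 'rV[R]_2).
Implicit Types (i j k m : 'Z_(n.*2)) (x y z d : 'rV[R]_2) (s t : R).
Notation offset := (vertex_offset P p).
Notation crosses := (crosses_sides P p).
Notation crossing_par := (crossing_param P p).

Variables phi rho : 'Z_(n.*2) -> R.

(** The first angle after phi k at which the line through p passes through the
    vertex m. For m = k this is half a turn later. *)
Definition next_angle_cand k m := if phi k < phi m then phi m else phi m + pi.

Definition next_vertex k := [arg min_(m < k) next_angle_cand k m]%O.

Definition next_angle k := next_angle_cand k (next_vertex k).

Definition vertex_cell k := pencil_line p @` `]phi k, next_angle k[.

Hypothesis hP : cppos P.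
Hypothesis hin : forall j, 0 < det2 (edge P j) (p - P j).
Hypothesis preg : region P p.
Hypothesis phi_itv : forall k, 0 <= phi k < pi.
Hypothesis rho0 : forall k, rho k != 0.
Hypothesis polarP : forall k, P k - p = rho k *: dir (phi k).
Hypothesis no2 : no_line_through_two_vertices P p.

Lemma offset_polar t k : offset (dir t) k = rho k * sin (t - phi k).
Proof. by rewrite /vertex_offset polarP det2Zl det2_dir. Qed.

Lemma next_angle_le k m : next_angle k <= next_angle_cand k m.
Proof.
by rewrite /next_angle /next_vertex; case: arg_minP => // l _ h; exact: h.
Qed.

Lemma next_angle_gt k : phi k < next_angle k.
Proof.
rewrite /next_angle /next_angle_cand; case: ifP => // _.
by have /andP[h1 _] := phi_itv (next_vertex k); have /andP[_ h2] := phi_itv k; lra.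
Qed.

Lemma next_angle_le_pi k : next_angle k <= phi k + pi.
Proof. by have := next_angle_le k k; rewrite /next_angle_cand ltxx. Qed.

(** The sign of the offset of the vertex m on the arc that begins at phi k,
    up to a positive factor. The angles lie in [0, pi), so t - phi m is
    in (- pi, 0) if phi k < phi m and in (0, pi) otherwise. *)
Definition arc_sign k m := if phi k < phi m then - rho m else rho m.

Lemma arc_sign_offset k m t : phi k < t < next_angle k ->
  0 < arc_sign k m * offset (dir t) m.
Proof.
move=> /andP[t1 t2]; have := lt_le_trans t2 (next_angle_le k m).
have /andP[k1 k2] := phi_itv k; have /andP[m1 m2] := phi_itv m.
have r2 : 0 < rho m ^+ 2 by rewrite exprn_even_gt0 //= rho0.
rewrite /next_angle_cand /arc_sign offset_polar; case: (ltP (phi k) (phi m)) => km h.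
  rewrite mulNr mulrA -mulrN -sinN -expr2 mulr_gt0 // sin_gt0_pi //.
  by apply/andP; split; lra.
by rewrite mulrA -expr2 mulr_gt0 // sin_gt0_pi //; apply/andP; split; lra.
Qed.

Lemma arc_sign_offset_ge0 k m t : phi k <= t <= next_angle k ->
  0 <= arc_sign k m * offset (dir t) m.
Proof.
move=> /andP[t1 t2]; have := le_trans t2 (next_angle_le k m).
have /andP[k1 k2] := phi_itv k; have /andP[m1 m2] := phi_itv m.
have r2 : 0 < rho m ^+ 2 by rewrite exprn_even_gt0 //= rho0.
rewrite /next_angle_cand /arc_sign offset_polar; case: (ltP (phi k) (phi m)) => km h.
  rewrite mulNr mulrA -mulrN -sinN -expr2 mulr_ge0 ?(ltW r2) // sin_ge0_pi //.
  by apply/andP; split; lra.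
by rewrite mulrA -expr2 mulr_ge0 ?(ltW r2) // sin_ge0_pi //; apply/andP; split; lra.
Qed.

Lemma arc_offset_neq0 k m t : phi k < t < next_angle k -> offset (dir t) m != 0.
Proof.
move=> /(arc_sign_offset m); apply: contraTneq => ->.
by rewrite mulr0 ltxx.
Qed.

Lemma arc_offset_prod k m m' t : phi k < t < next_angle k ->
  (offset (dir t) m * offset (dir t) m' < 0) = (arc_sign k m * arc_sign k m' < 0).
Proof.
move=> tk; have h := arc_sign_offset m tk; have h' := arc_sign_offset m' tk.
have := mulr_gt0 h h'; rewrite mulrACA => hh.
by apply/idP/idP => h0; [rewrite -(nmulr_lgt0 _ h0)|rewrite -(nmulr_rgt0 _ h0)].
Qed.

(** The signs of all offsets are constant on the arc. *)
Lemma arc_crosses k i j t t' : phi k < t < next_angle k -> phi k < t' < next_angle k ->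
  crosses (dir t) i j -> crosses (dir t') i j.
Proof.
move=> tk tk' /and3P[ij]; rewrite !(arc_offset_prod _ _ tk) => hi hj.
by rewrite /crosses_sides ij !(arc_offset_prod _ _ tk') hi.
Qed.

Lemma vertex_pencil_line k : pencil_line p (phi k) (P k).
Proof. by apply/pencil_line_dirP; rewrite polarP det2Zl det2vv mulr0. Qed.

Lemma phi_inj : injective phi.
Proof.
move=> k l e; apply: (no2 (L := pencil_line p (phi k))); first by exists (phi k).
- exact: vertex_pencil_line.
- by rewrite e; exact: vertex_pencil_line.
Qed.

Lemma next_angle_vertex k : pencil_line p (next_angle k) (P (next_vertex k)).
Proof.
rewrite /next_angle /next_angle_cand; case: ifP => _; first exact: vertex_pencil_line.
rewrite (pencil_line_eq p (b := phi (next_vertex k))); first exact: vertex_pencil_line.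
by rewrite opprD addNKr sinN sinpi oppr0.
Qed.

Lemma open_arc_vertex_cell k : open_arc p (vertex_cell k).
Proof. by exists (phi k), (next_angle k); split; [exact: next_angle_gt|exact: next_angle_le_pi|]. Qed.

Lemma vertex_cell_mid k : exists t, phi k < t < next_angle k.
Proof.
exists ((phi k + next_angle k) / 2); have := next_angle_gt k.
by move=> ?; apply/andP; split; lra.
Qed.

Lemma vertex_cell_mem k t : phi k < t < next_angle k -> vertex_cell k (pencil_line p t).
Proof. by move=> tk; exists t => //=; rewrite in_itv. Qed.

Lemma vertex_cellP k L : vertex_cell k L ->
  exists2 t, phi k < t < next_angle k & pencil_line p t = L.
Proof. by move=> [t /= + <-]; rewrite in_itv /= => tk; exists t. Qed.

(** After a shift by a multiple of pi, the arc A and the cell overlap as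
    intervals of angles. Both ends of the cell are angles of vertex lines, so A
    does not reach beyond them. *)
Lemma open_arc_sub_vertex_cell A k L : open_arc p A ->
  (forall L' m, A L' -> ~ L' (P m)) -> A L -> vertex_cell k L -> A `<=` vertex_cell k.
Proof.
move=> [a [b [ab _ ->]]] noV [t /= + tL] /vertex_cellP[u uk uL].
rewrite in_itv /= => /andP[at_ tb].
have [delta [/andP[d1 d2] shift]] := pencil_line_shift p (phi k) t.
have uE : u = t + delta.
  apply/eqP; rewrite -subr_eq0; apply/eqP/sin_eq0_small.
    have := next_angle_le_pi k; case/andP: uk => u1 u2 h.
    by apply/andP; split; lra.
  by apply: (@pencil_line_sin _ p); rewrite shift tL uL.
have off v : pencil_line p v = pencil_line p (phi k) \/ 
             pencil_line p v = pencil_line p (next_angle k) -> ~ (a < v < b).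
  move=> e avb.
  have Av : (pencil_line p @` `]a, b[) (pencil_line p v).
    by exists v => //=; rewrite in_itv.
  case: e => e; rewrite e in Av.
    exact: (noV _ k Av (vertex_pencil_line k)).
  exact: (noV _ _ Av (next_angle_vertex k)).
move=> _ [v /= + <-]; rewrite in_itv /= => /andP[av vb].
rewrite -shift; apply: vertex_cell_mem.
case/andP: uk => u1 u2; rewrite uE in u1 u2.
apply/andP; split; rewrite ltNge; apply/negP => h.
  apply: (off (phi k - delta)); last by apply/andP; split; lra.
  by left; rewrite -shift subrK.
apply: (off (next_angle k - delta)); last by apply/andP; split; lra.
by right; rewrite -shift subrK.
Qed.

(** A line through a vertex meets the boundary at that vertex, which is not in
    any open side. *)
Lemma chord_ends_no_vertex A i j : A `<=` pencil p -> A `<=` chord_ends P i j ->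
  forall L m, A L -> ~ L (P m).
Proof.
move=> Ap Aij L m AL; have [t _ e] := Ap _ AL.
have := Aij _ AL; rewrite -e => /(chord_ends_offset hP m (dir_neq0 t)) f0 /pencil_line_dirP h.
by move: f0; rewrite /vertex_offset h eqxx.
Qed.

Lemma open_arc_pencil A : open_arc p A -> A `<=` pencil p.
Proof. by move=> [a [b [_ _ ->]]] _ [t _ <-]; exists t. Qed.

Lemma vertex_cell_chord_ends k i j t : phi k < t < next_angle k -> crosses (dir t) i j ->
  vertex_cell k `<=` chord_ends P i j.
Proof.
move=> tk c _ /vertex_cellP[u uk <-].
by apply/(chord_endsP hP hin _ _ (dir_neq0 u)); exact: (arc_crosses tk uk).
Qed.

(** Maximality: a larger arc with ends in the same open sides would contain a
    line through a vertex. *)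
Lemma cell_on_vertex_cell k i j t : phi k < t < next_angle k -> crosses (dir t) i j ->
  cell_on P p i j (vertex_cell k).
Proof.
move=> tk c; split; [exact: open_arc_vertex_cell|exact: (vertex_cell_chord_ends tk c)|].
move=> A oA Aij kA; apply/seteqP; split=> //.
apply: (@open_arc_sub_vertex_cell _ _ (pencil_line p t)) => //.
- exact: (chord_ends_no_vertex (open_arc_pencil oA) Aij).
- by apply: kA; exact: vertex_cell_mem.
- exact: vertex_cell_mem.
Qed.

Lemma arc_exists_crosses k : exists t i j, phi k < t < next_angle k /\ crosses (dir t) i j.
Proof.
have [t tk] := vertex_cell_mid k.
have [i [j c]] := exists_crosses preg (fun m => arc_offset_neq0 m tk).
by exists t, i, j.
Qed.

Lemma cell_vertex_cell k : cell P p (vertex_cell k).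
Proof.
have [t [i [j [tk c]]]] := arc_exists_crosses k.
by exists i, j; exact: (cell_on_vertex_cell tk c).
Qed.

(** Shift t to an interval of length pi that begins at the least phi, and take
    the last vertex angle before it. *)
Lemma vertex_cells_cover t : (forall k, offset (dir t) k != 0) ->
  exists k, vertex_cell k (pencil_line p t).
Proof.
move=> f0.
pose k0 := [arg min_(m < (0 : 'Z_(n.*2))) phi m]%O.
have k0P m : phi k0 <= phi m.
  by rewrite /k0; case: arg_minP => // l _; apply.
have [delta [/andP[d1 d2] shift]] := pencil_line_shift p (phi k0) t.
pose k := [arg max_(m > k0 | phi m <= t + delta) phi m]%O.
have [kt kP] : phi k <= t + delta /\ forall m, phi m <= t + delta -> phi m <= phi k.
  by rewrite /k; case: arg_maxP => // l h1 h2; split.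
exists k; rewrite -shift; apply: vertex_cell_mem; apply/andP; split.
  rewrite lt_neqAle kt andbT; apply/eqP => e.
  have := vertex_pencil_line k; rewrite e shift pencil_line_dirP => h.
  by have := f0 k; rewrite /vertex_offset h eqxx.
rewrite /next_angle; set m := next_vertex k; rewrite /next_angle_cand.
case: (ltP (phi k) (phi m)) => km; last by have := k0P m; lra.
by rewrite ltNge; apply/negP => /kP; rewrite leNgt km.
Qed.

Lemma cell_is_vertex_cell C : cell P p C -> exists k, C = vertex_cell k.
Proof.
move=> [i [j [oC Cij Cmax]]].
have noV := chord_ends_no_vertex (open_arc_pencil oC) Cij.
have [a [b [ab _ CE]]] := oC.
pose t := (a + b) / 2.
have Ct : C (pencil_line p t).
  by rewrite CE; exists t => //=; rewrite in_itv /= /t; apply/andP; split; lra.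
have c : crosses (dir t) i j := cell_crosses_dir hP hin Cij Ct.
have f0 k : offset (dir t) k != 0.
  by apply/eqP => h; apply: (noV _ k Ct); apply/pencil_line_dirP.
have [k kt] := vertex_cells_cover f0; exists k; apply/esym/Cmax.
- exact: open_arc_vertex_cell.
- have [u uk e] := vertex_cellP kt.
  apply: (vertex_cell_chord_ends uk); apply: (cell_crosses_dir hP hin Cij).
  by rewrite e.
- exact: (open_arc_sub_vertex_cell oC noV Ct kt).
Qed.

(** Two such arcs are disjoint modulo pi: the one with the smaller starting
    angle ends before the other begins, and the other ends before the first
    begins again. *)
Lemma vertex_cell_inj : injective vertex_cell.
Proof.
have aux k l : phi k < phi l -> vertex_cell k <> vertex_cell l.
  move=> kl e; have [t tk] := vertex_cell_mid k.
  have := vertex_cell_mem tk; rewrite e => /vertex_cellP[u ul e'].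
  have := next_angle_le k l; rewrite /next_angle_cand kl => h.
  have := next_angle_le l k; rewrite /next_angle_cand ltNge (ltW kl) /= => h'.
  case/andP: tk => t1 t2; case/andP: ul => u1 u2.
  have : 0 < sin (u - t) by apply: sin_gt0_pi; apply/andP; split; lra.
  by rewrite (pencil_line_sin (esym e')) ltxx.
move=> k l e; apply: phi_inj; have [kl|kl|//] := ltgtP (phi k) (phi l).
  by case: (aux _ _ kl).
by case: (aux _ _ kl).
Qed.

Lemma card_cells : [set C | cell P p C] #= `I_(n.*2).
Proof.
have -> : [set C | cell P p C] = range vertex_cell.
  apply/seteqP; split=> C; last by move=> [k _ <-]; exact: cell_vertex_cell.
  by move=> /cell_is_vertex_cell[k ->]; exists k.
rewrite (card_eql (inj_card_eq (in2W vertex_cell_inj))).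
have n2 : (1 < n.*2)%N by case: hP => n1 _ _ _ _; rewrite (leq_trans n1) // -addnn leq_addr.
by rewrite card_eq_sym; apply: card_eq_trans (@card_II _); rewrite (Zp_cast n2).
Qed.

End Cells.

(** * One-sided limits of the envelope *)

Section Limits.
Variables (R : realType) (n : nat) (P : 'Z_(n.*2) -> 'rV[R]_2) (p : 'rV[R]_2).
Implicit Types (i j k m : 'Z_(n.*2)) (x y z d : 'rV[R]_2) (s t : R).
Notation offset := (vertex_offset P p).
Notation crosses := (crosses_sides P p).
Notation crossing_par := (crossing_param P p).
Notation envelope_curve := (envelope_curve P p).

Hypothesis hP : cppos P.
Hypothesis hin : forall j, 0 < det2 (edge P j) (p - P j).

Lemma crossing_par_itv_weak d i : offset d i != offset d (i + 1) ->
  offset d i * offset d (i + 1) <= 0 -> 0 <= crossing_par d i <= 1.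
Proof.
rewrite /crossing_param; set a := offset d i; set b := offset d (i + 1).
rewrite -subr_eq0 => ab h.
have ab2 : 0 < (a - b) ^+ 2 by rewrite exprn_even_gt0.
have -> : a / (a - b) = a * (a - b) / (a - b) ^+ 2 by field.
by rewrite divr_ge0 ?ler_pdivrMr //; nra.
Qed.

(** Equal offsets with nonpositive product both vanish. *)
Lemma weak_crossing_neq d i : d != 0 -> offset d i * offset d (i + 1) <= 0 ->
  offset d i != offset d (i + 1).
Proof.
move=> d0 h; apply/eqP => e.
have f0 : offset d i = 0.
  by apply/eqP; rewrite -sqrf_eq0 eq_le sqr_ge0 expr2 {2}e h.
have := vertices_of_side_offset hin d0 f0.
by rewrite -e f0 eqxx.
Qed.

(** As P k - p is a multiple c d of d, the two determinants that place p to the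
    left of the sides at k are -c and c times the offsets of the neighbours. *)
Lemma vertex_neighbors d k : d != 0 -> offset d k = 0 ->
  offset d (k - 1) * offset d (k + 1) < 0.
Proof.
move=> d0 fk; have [c ec] : exists c, P k - p = c *: d.
  by apply: (det2_eq0P d0); rewrite det2C -/(offset d k) fk oppr0.
have h1 := hin k; have h2 := hin (k - 1).
have e1 : det2 (edge P k) (p - P k) = - c * offset d (k + 1).
  by rewrite -(opprB (P k) p) ec det2Nr det2Zr mulNr -(offset_edge P p) fk subr0.
have e2 : det2 (edge P (k - 1)) (p - P (k - 1)) = c * offset d (k - 1).
  have -> : p - P (k - 1) = edge P (k - 1) - (P k - p).
    by rewrite /edge subrK opprB [RHS]addrC addrA subrK.
  rewrite det2Dr det2vv add0r det2Nr ec det2Zr -(offset_edge P p) subrK fk; ring.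
rewrite e1 in h1; rewrite e2 in h2; have := mulr_gt0 h1 h2.
have -> : - c * offset d (k + 1) * (c * offset d (k - 1)) =
  - (c ^+ 2 * (offset d (k - 1) * offset d (k + 1))) by ring.
rewrite oppr_gt0 pmulr_rlt0 // lt_neqAle sqr_ge0 andbT eq_sym sqrf_eq0.
by apply: contraTneq h1 => ->; rewrite oppr0 mul0r ltxx.
Qed.

Lemma affine_qcurve_cvg (c0 c1 c2 : 'rV[R]_3) (T : Type) (G : set_system T)
    {FG : Filter G} (h : T -> R) s : qcurve c0 c1 c2 s 0 2%:R != 0 ->
  h @ G --> s -> affine (qcurve c0 c1 c2 (h r)) @[r --> G] --> affine (qcurve c0 c1 c2 s).
Proof.
move=> q0 hs.
have h2 : (h r) ^+ 2 @[r --> G] --> s ^+ 2 by under eq_fun do rewrite expr2; rewrite expr2; apply: cvgM.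
apply: cvgZ.
  apply: cvgV => //.
  rewrite (_ : (fun r => _) = (fun r => c0 0 2%:R + h r * c1 0 2%:R + h r ^+ 2 * c2 0 2%:R)); last first.
    by apply/funext => r; rewrite !mxE.
  rewrite (_ : qcurve _ _ _ _ _ _ = c0 0 2%:R + s * c1 0 2%:R + s ^+ 2 * c2 0 2%:R); last by rewrite !mxE.
  by apply: cvgD; [apply: cvgD; [exact: cvg_cst|exact: cvgMr_tmp]|exact: cvgMr_tmp].
pose L (w : 'rV[R]_(2 + 1)) : 'rV[R]_2 := lsubmx w.
have qE r : L (qcurve c0 c1 c2 r) = L c0 + r *: L c1 + r ^+ 2 *: L c2.
  by rewrite /qcurve /L !linearD !linearZ.
rewrite -[X in _ --> X]/(L _) qE.
rewrite (_ : (fun r => _) = (fun r => L c0 + h r *: L c1 + h r ^+ 2 *: L c2)).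
  by apply: cvgD; [apply: cvgD; [exact: cvg_cst|exact: cvgZr_tmp]|exact: cvgZr_tmp].
by apply/funext => r; rewrite -qE.
Qed.

Lemma envelope_limit_unique (G : set_system R) {FG : ProperFilter G} z z' :
  envelope_limit P p G z -> envelope_limit P p G z' -> z = z'.
Proof.
move=> [g ng cg] [g' ng' cg'].
apply: (@cvg_unique _ _ (g @ G)) => //.
apply: cvg_trans cg'; apply: near_eq_cvg; near=> t.
apply: (@envelope_pt_unique _ (reflected_pencil P p) t); by near: t.
Unshelve. all: by end_near. Qed.

(** In the limit the sign changes of the offsets persist weakly. It remains to
    see that at most one end of the chord becomes a vertex. If both did, there
    would be only one vertex on the line, hence i and j would be adjacent and
    the common vertex would have neighbours with offsets of the same sign,
    contrary to [vertex_neighbors]. *)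
Lemma envelope_limit_crosses (G : set_system R) {FG : ProperFilter G} (theta : R) i j :
  G --> theta -> (\forall t \near G, crosses (dir t) i j) ->
  (forall m m', offset (dir theta) m = 0 -> offset (dir theta) m' = 0 -> m = m') ->
  envelope_limit P p G (affine (envelope_curve i j (crossing_par (dir theta) i))).
Proof.
move=> Gt Gc uniq0.
have cvo m : offset (dir t) m @[t --> G] --> offset (dir theta) m.
  exact: (cvg_comp _ _ Gt (@offset_dir_cvg _ _ P p theta m)).
have d0 := dir_neq0 theta.
have [t0 /and3P[ij _ _]] := filter_ex Gc.
have le0 m : (\forall t \near G, offset (dir t) m * offset (dir t) (m + 1) < 0) ->
    offset (dir theta) m * offset (dir theta) (m + 1) <= 0.
  move=> h; apply: (cvgr_to_le (cvgM (cvo m) (cvo (m + 1)))).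
  by near=> t; apply/ltW; near: t.
have Gi : \forall t \near G, offset (dir t) i * offset (dir t) (i + 1) < 0.
  by near=> t; suff /and3P[] : crosses (dir t) i j by []; near: t.
have Gj : \forall t \near G, offset (dir t) j * offset (dir t) (j + 1) < 0.
  by near=> t; suff /and3P[] : crosses (dir t) i j by []; near: t.
have li := le0 i Gi; have lj := le0 j Gj.
have ni := weak_crossing_neq d0 li; have nj := weak_crossing_neq d0 lj.
set s := crossing_par (dir theta) i.
have s01 : 0 <= s <= 1 := crossing_par_itv_weak ni li.
have t01 := crossing_par_itv_weak nj lj.
(* The sides a and a + 1 cannot both be crossed near theta if their common
   vertex is on the limit line. *)
have no_common a b : a + 1 = b -> offset (dir theta) b = 0 ->
    (\forall t \near G, offset (dir t) a * offset (dir t) (a + 1) < 0) ->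
    (\forall t \near G, offset (dir t) b * offset (dir t) (b + 1) < 0) -> False.
  move=> ab fb Ga Gb; have := vertex_neighbors d0 fb; rewrite -{1}ab addrK => neg.
  have Gn : \forall t \near G, offset (dir t) a * offset (dir t) (b + 1) < 0.
    exact: (cvgr_lt _ (cvgM (cvo a) (cvo (b + 1)))).
  have [t [[h1 h2] h3]] := filter_ex (filterI (filterI Ga Gb) Gn).
  rewrite ab in h1; have := nmulr_rgt0 (offset (dir t) a * offset (dir t) b) h2.
  nra.
have strict : (0 < s < 1) || (0 < crossing_par (dir theta) j < 1).
  have [h|h] := ltP (offset (dir theta) i * offset (dir theta) (i + 1)) 0.
    by rewrite /s crossing_par_itv.
  have [h'|h'] := ltP (offset (dir theta) j * offset (dir theta) (j + 1)) 0.
    by rewrite (crossing_par_itv h') orbT.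
  have /eqP : offset (dir theta) i * offset (dir theta) (i + 1) = 0 by apply/eqP; rewrite eq_le li.
  have /eqP : offset (dir theta) j * offset (dir theta) (j + 1) = 0 by apply/eqP; rewrite eq_le lj.
  rewrite !mulf_eq0 => /orP[]/eqP fj /orP[]/eqP fi.
  - by case/eqP: ij; exact: uniq0.
  - by case: (no_common i j _ fj Gi Gj); exact: uniq0.
  - by case: (no_common j i _ fi Gj Gi); exact: uniq0.
  - by case/eqP: ij; apply: (addIr 1); exact: uniq0.
have [c c0 ec] := crossing_par_collinear hin d0 s01 (crossing_on_line ni).
have D0 : coefD0 P p i j + s * coefD1 P i j != 0.
  by rewrite -(offset_chord_dirD P p) ec !offsetZ -mulrBr mulf_neq0 // subr_eq0.
have tE : (coefN0 P p i j + s * coefN1 P p i j) / (coefD0 P p i j + s * coefD1 P i j) =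
    crossing_par (dir theta) j.
  by rewrite -crossing_par_chord_dir ec crossing_parZ.
have Z2 : 0 < envelope_curve i j s 0 2%:R.
  by apply: envelope_curve_third_gt0 => //; rewrite tE.
exists (fun t => affine (envelope_curve i j (crossing_par (dir t) i))).
  near=> t; have ct : crosses (dir t) i j by near: t.
  by apply/(envelope_pencil hP hin _ ct).
apply: affine_qcurve_cvg; first by rewrite gt_eqF.
apply: cvgM; first exact: cvo.
by apply: cvgV; [rewrite subr_eq0|exact: cvgB].
Unshelve. all: by end_near. Qed.

End Limits.

(** * Conic arcs and transition segments *)

Section Arcs.
Variables (R : realType) (n : nat) (P : 'Z_(n.*2) -> 'rV[R]_2) (p : 'rV[R]_2).
Implicit Types (i j k l m : 'Z_(n.*2)) (x y z d : 'rV[R]_2) (s t : R).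
Notation offset := (vertex_offset P p).
Notation crosses := (crosses_sides P p).
Notation crossing_par := (crossing_param P p).
Notation envelope_curve := (envelope_curve P p).
Variables phi rho : 'Z_(n.*2) -> R.
Notation next_angle := (next_angle phi).
Notation next_vertex := (next_vertex phi).
Notation vertex_cell := (vertex_cell p phi).
Notation arc_sign := (arc_sign phi rho).

Hypothesis hP : cppos P.
Hypothesis hin : forall j, 0 < det2 (edge P j) (p - P j).
Hypothesis preg : region P p.
Hypothesis phi_itv : forall k, 0 <= phi k < pi.
Hypothesis rho0 : forall k, rho k != 0.
Hypothesis polarP : forall k, P k - p = rho k *: dir (phi k).
Hypothesis no2 : no_line_through_two_vertices P p.

(** The Pluecker relation again, now for a finite difference. It shows that s
    is monotone in the angle. *)
Lemma crossing_par_sub t t' i :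
  offset (dir t) i != offset (dir t) (i + 1) -> offset (dir t') i != offset (dir t') (i + 1) ->
  crossing_par (dir t') i - crossing_par (dir t) i =
  det2 (edge P i) (p - P i) * sin (t' - t) /
    ((offset (dir t) i - offset (dir t) (i + 1)) * (offset (dir t') i - offset (dir t') (i + 1))).
Proof.
rewrite -!(subr_eq0 (offset _ i)) => h h'.
have -> : det2 (edge P i) (p - P i) * sin (t' - t) =
    offset (dir t) i * offset (dir t') (i + 1) - offset (dir t') i * offset (dir t) (i + 1).
  rewrite /vertex_offset -det2_plucker det2_dir; congr (_ * _).
  by rewrite /edge !det2E !mxE; ring.
by rewrite /crossing_param; field; rewrite h h'.
Qed.

(** The closed arc is allowed here: at its ends one offset may vanish, but not
    those of both ends of a side. *)
Lemma arc_edge_sign k i t : arc_sign k i * arc_sign k (i + 1) < 0 ->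
  phi k <= t <= next_angle k ->
  0 < arc_sign k i * (offset (dir t) i - offset (dir t) (i + 1)).
Proof.
move=> ab tk; have h1 := arc_sign_offset_ge0 phi_itv rho0 polarP i tk.
have h2 := arc_sign_offset_ge0 phi_itv rho0 polarP (i + 1) tk.
move: ab h1 h2; set a := arc_sign k i; set b := arc_sign k (i + 1) => ab h1 h2.
have a0 : a != 0 by apply: contraTneq ab => ->; rewrite mul0r ltxx.
have b0 : b != 0 by apply: contraTneq ab => ->; rewrite mulr0 ltxx.
have b2 : 0 < b ^+ 2 by rewrite exprn_even_gt0.
have h3 : a * offset (dir t) (i + 1) <= 0.
  rewrite -(pmulr_rle0 _ b2).
  have -> : b ^+ 2 * (a * offset (dir t) (i + 1)) = a * b * (b * offset (dir t) (i + 1)) by ring.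
  by rewrite nmulr_rle0.
rewrite mulrBr subr_gt0 lt_neqAle (le_trans h3 h1) andbT.
rewrite (inj_eq (mulfI a0)) eq_sym; apply: (weak_crossing_neq hin (dir_neq0 t)).
have a2 : 0 < a ^+ 2 by rewrite exprn_even_gt0.
rewrite -(pmulr_rle0 _ a2).
have -> : a ^+ 2 * (offset (dir t) i * offset (dir t) (i + 1)) =
  (a * offset (dir t) i) * (a * offset (dir t) (i + 1)) by ring.
by rewrite mulr_ge0_le0.
Qed.

Lemma crossing_par_mono k i t t' : arc_sign k i * arc_sign k (i + 1) < 0 ->
  phi k <= t -> t < t' -> t' <= next_angle k -> t' - t < pi ->
  crossing_par (dir t) i < crossing_par (dir t') i.
Proof.
move=> ab kt tt' t'k small.
have h : phi k <= t <= next_angle k by rewrite kt (le_trans (ltW tt')).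
have h' : phi k <= t' <= next_angle k by rewrite t'k (le_trans kt (ltW tt')).
have e := arc_edge_sign ab h; have e' := arc_edge_sign ab h'.
have neq u : 0 < arc_sign k i * (offset (dir u) i - offset (dir u) (i + 1)) ->
    offset (dir u) i != offset (dir u) (i + 1).
  by apply: contraTneq => ->; rewrite subrr mulr0 ltxx.
rewrite -subr_gt0 crossing_par_sub ?neq // divr_gt0 //.
  by rewrite mulr_gt0 // sin_gt0_pi // subr_gt0 tt'.
have := mulr_gt0 e e'; rewrite mulrACA pmulr_rgt0 // -expr2 exprn_even_gt0 //=.
by apply: contraTneq ab => ->; rewrite mul0r ltxx.
Qed.

(** The parameter s is continuous and increasing on the closed arc of angles,
    so it maps the open arc onto the open interval between the end values. *)
Lemma vertex_cell_params k i j t0 : phi k < t0 < next_angle k -> crosses (dir t0) i j ->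
  let a := crossing_par (dir (phi k)) i in
  let b := crossing_par (dir (next_angle k)) i in
  a < b /\ [set s | 0 < s < 1 /\ vertex_cell k (line p (side_pt P i s))] = `]a, b[%classic.
Proof.
move=> tk c a b.
have := c => /and3P[_ + _]; rewrite (arc_offset_prod phi_itv rho0 polarP _ _ tk) => ab.
have len := next_angle_le_pi phi k.
have mono := crossing_par_mono ab.
have [t1 t2] := andP tk.
have inside t : phi k < t < next_angle k -> a < crossing_par (dir t) i < b.
  by move=> /andP[h1 h2]; apply/andP; split; apply: mono => //; lra.
have [ia ib] := andP (inside _ tk).
have ab' : a < b by apply: lt_trans ib.
split=> //; apply/seteqP; split=> s /=; rewrite in_itv /=.
  move=> [s01 /vertex_cellP[t htk e]].
  suff -> : s = crossing_par (dir t) i by exact: inside.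
  apply: crossing_par_unique.
    by have := arc_crosses phi_itv rho0 polarP tk htk c => /and3P[_ /prod_lt0_neq].
  apply/(pencil_lineP _ _ (dir_neq0 t)); rewrite -pencil_lineE e.
  by exists 1; rewrite scale1r addrC subrK.
move=> sab.
have [|||t + st] := @IVT R (fun t => crossing_par (dir t) i) (phi k) (next_angle k) s.
- by apply/ltW/next_angle_gt.
- apply: derivable_within_continuous => t; rewrite in_itv /= => htk.
  have := arc_edge_sign ab htk => q.
  apply: (crossing_par_derive hin _).1.
  by apply: contraTneq q => ->; rewrite subrr mulr0 ltxx.
- have [as_ sb] := andP sab.
  by rewrite -/a -/b (min_idPl (ltW ab')) (max_idPr (ltW ab')) !ltW.
rewrite in_itv /= => /andP[kt tn].
have [sa sb] := andP sab.
have htk : phi k < t < next_angle k.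
  rewrite !lt_neqAle kt tn !andbT; apply/andP; split; apply/eqP => e.
    by move: sa; rewrite -st -e /a ltxx.
  by move: sb; rewrite -st e /b ltxx.
have ct := arc_crosses phi_itv rho0 polarP tk htk c.
have [s01 lE _] := crosses_chord_dir hin ct.
by rewrite -st; split=> //; rewrite -lE; exact: vertex_cell_mem.
Qed.

Lemma conic_arc_vertex_cell k : conic_arc (cell_envelope P p (vertex_cell k)).
Proof.
have [t [i [j [tk c]]]] := arc_exists_crosses preg phi_itv rho0 polarP k.
have [ab SE] := vertex_cell_params tk c.
have [oC Cij _] := cell_on_vertex_cell hP hin phi_itv rho0 polarP tk c.
have Cp := open_arc_pencil oC.
rewrite (cell_envelopeE hP hin Cp Cij) SE.
do 5!eexists; split; [exact: param_conicP|exact: ab| |reflexivity].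
move=> s sab.
have Ss : [set s | 0 < s < 1 /\ vertex_cell k (line p (side_pt P i s))] s.
  by rewrite SE /= in_itv.
have := crosses_third_gt0 hP hin (cell_crosses hP hin Cij Ss).
by rewrite lt0r => /andP[].
Qed.

Lemma vertex_line_sin k theta0 theta : pencil_line p theta0 (P k) ->
  pencil_line p theta (P k) -> sin (theta - theta0) = 0.
Proof.
rewrite !pencil_line_dirP polarP !det2Zl !det2_dir => /eqP + /eqP.
rewrite !mulf_eq0 !(negPf (rho0 _)) /= => /eqP s0 /eqP s1.
rewrite (_ : theta - theta0 = (theta - phi k) - (theta0 - phi k)); last by ring.
by rewrite sinB s0 s1 mul0r mulr0 subr0.
Qed.

(** Two cells that end at the same vertex line overlap just before it, hence
    coincide. By finiteness every vertex line is then the right end of a cell,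
    which supplies the cell to the left of a transition. *)
Lemma next_vertex_inj : injective next_vertex.
Proof.
move=> k l e; apply: (vertex_cell_inj phi_itv polarP no2).
have sinE : sin (next_angle l - next_angle k) = 0.
  apply: (vertex_line_sin (next_angle_vertex polarP k)).
  by rewrite e; exact: (next_angle_vertex polarP).
have gk := next_angle_gt phi_itv k; have gl := next_angle_gt phi_itv l.
(* A step back from the right ends that stays inside both arcs. *)
pose eta := Num.min (next_angle k - phi k) (next_angle l - phi l) / 2.
have eta0 : 0 < eta by rewrite divr_gt0 // lt_min !subr_gt0 gk.
have etak : eta < next_angle k - phi k.
  rewrite (@le_lt_trans _ _ ((next_angle k - phi k) / 2)) //; last by lra.
  by rewrite ler_pM2r ?invr_gt0 // ge_min lexx.
have etal : eta < next_angle l - phi l.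
  rewrite (@le_lt_trans _ _ ((next_angle l - phi l) / 2)) //; last by lra.
  by rewrite ler_pM2r ?invr_gt0 // ge_min lexx orbT.
have Lk : vertex_cell k (pencil_line p (next_angle k - eta)).
  by apply: vertex_cell_mem; apply/andP; split; lra.
have Ll : vertex_cell l (pencil_line p (next_angle k - eta)).
  rewrite (@pencil_line_eq _ p _ (next_angle l - eta)); last first.
    by rewrite -[RHS]sinE; congr sin; ring.
  by apply: vertex_cell_mem; apply/andP; split; lra.
have sub a b L : vertex_cell a L -> vertex_cell b L -> vertex_cell a `<=` vertex_cell b.
  move=> La Lb; apply: (open_arc_sub_vertex_cell polarP _ _ La Lb).
    exact: open_arc_vertex_cell.
  move=> L' m /vertex_cellP[t ta <-] /pencil_line_dirP h.
  by have := arc_offset_neq0 phi_itv rho0 polarP m ta; rewrite /vertex_offset h eqxx.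
by apply/seteqP; split; [exact: sub Lk Ll|exact: sub Ll Lk].
Qed.

(** The limit is expressed at a fixed angle theta0 of the transition line, so
    that it does not depend on the angle theta that represents this line. *)
Lemma transition_limit (theta0 theta : R) (G : set_system R) {FG : ProperFilter G} i j :
  sin (theta - theta0) = 0 -> G --> theta ->
  (\forall t \near G, crosses (dir (t - (theta - theta0))) i j) ->
  envelope_limit P p G (affine (envelope_curve i j (crossing_par (dir theta0) i))).
Proof.
move=> s0 Gt Gc.
have dir_sin t t' : sin (t' - t) = 0 -> exists2 c, c != 0 & dir t' = c *: dir t.
  rewrite -det2_dir => /(det2_eq0P (dir_neq0 t))[c e]; exists c => //.
  by apply: contraNneq (dir_neq0 t') => c0; rewrite e c0 scale0r.
have [c c0 ec] := dir_sin _ _ s0.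
rewrite -(crossing_parZ P p (dir theta0) i c0) -ec.
apply: (envelope_limit_crosses hP hin Gt).
  near=> t; have [b b0 ->] : exists2 b, b != 0 & dir t = b *: dir (t - (theta - theta0)).
    by apply: dir_sin; rewrite opprB addrC subrK.
  by rewrite crossesZ //; near: t.
move=> m m' hm hm'; apply: (no2 (L := pencil_line p theta)); first by exists theta.
- exact/pencil_line_dirP.
- exact/pencil_line_dirP.
Unshelve. all: by end_near. Qed.

Lemma transition_right k : exists z, forall theta, pencil_line p theta (P k) ->
  envelope_limit P p theta^'+ z.
Proof.
have [t [i [j [tk c]]]] := arc_exists_crosses preg phi_itv rho0 polarP k.
exists (affine (envelope_curve i j (crossing_par (dir (phi k)) i))) => theta Pk.
have s0 := vertex_line_sin (vertex_pencil_line polarP k) Pk.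
apply: (@transition_limit _ theta _ _ i j s0); first exact: cvg_at_right_filter cvg_id.
near=> u; apply: (arc_crosses phi_itv rho0 polarP tk _ c).
have u1 : theta < u by near: u; exact: nbhs_right_gt.
have u2 : u < theta + (next_angle k - phi k).
  near: u; apply: nbhs_right_lt.
  by have := next_angle_gt phi_itv k; lra.
by apply/andP; split; lra.
Unshelve. all: by end_near. Qed.

Lemma transition_left k : exists z, forall theta, pencil_line p theta (P k) ->
  envelope_limit P p theta^'- z.
Proof.
have /codomP[l kl] := injF_onto next_vertex_inj k.
have [t [i [j [tl c]]]] := arc_exists_crosses preg phi_itv rho0 polarP l.
exists (affine (envelope_curve i j (crossing_par (dir (next_angle l)) i))) => theta Pk.
have nl : pencil_line p (next_angle l) (P k) by rewrite kl; exact: (next_angle_vertex polarP).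
have s0 := vertex_line_sin nl Pk.
apply: (@transition_limit _ theta _ _ i j s0); first exact: cvg_at_left_filter cvg_id.
near=> u; apply: (arc_crosses phi_itv rho0 polarP tl _ c).
have u1 : u < theta by near: u; exact: nbhs_left_lt.
have u2 : theta - (next_angle l - phi l) < u.
  near: u; apply: nbhs_left_gt.
  by have := next_angle_gt phi_itv l; lra.
by apply/andP; split; lra.
Unshelve. all: by end_near. Qed.

Lemma transition_segment_unique k : exists2 T, transition_segment P p k T &
  forall T', transition_segment P p k T' -> T' = T.
Proof.
have [z1 h1] := transition_left k; have [z2 h2] := transition_right k.
have Pk := vertex_pencil_line polarP k.
exists (segment z1 z2).
  by exists (phi k), z1, z2; split=> //; [exact: h1|exact: h2].
move=> T' [theta [y1 [y2 [Pt l1 l2 ->]]]].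
by rewrite (envelope_limit_unique l1 (h1 _ Pt)) (envelope_limit_unique l2 (h2 _ Pt)).
Qed.

End Arcs.

Theorem theorem6p4 (R : realType) (n : nat) (P : 'Z_(n.*2) -> 'rV[R]_2)
    (p : 'rV[R]_2) (hP : cppos P) (hp : interior (region P) p) :
  (forall (C : set (set 'rV[R]_2)) (i j : 'Z_(n.*2)), cell_on P p i j C ->
    let Delta0 := det2 (P i - p) (edge P j) in
    let Delta1 := det2 (edge P i) (edge P j) in
    let N0 := - det2 (P i - p) (P j - p) in
    let N1 := - det2 (edge P i) (P j - p) in
    let t := fun s : R => (N0 + s * N1) / (Delta0 + s * Delta1) in
    let u0 := lift_pt (P (opp_idx i)) in
    let u1 := lift_vec (edge P (opp_idx i)) in
    let v0 := Delta0 *: lift_pt (P (opp_idx j))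
              + N0 *: lift_vec (edge P (opp_idx j)) in
    let v1 := Delta1 *: lift_pt (P (opp_idx j))
              + N1 *: lift_vec (edge P (opp_idx j)) in
    let l0 := cross u0 v0 in
    let l1 := cross u0 v1 + cross u1 v0 in
    let l2 := cross u1 v1 in
    let ell := fun s : R => cross (u0 + s *: u1) (v0 + s *: v1) in
    let regular := fun s : R => cross (ell s) (derive1 ell s) != 0 in
    let c0 := cross l0 l1 in
    let c1 := 2 *: cross l0 l2 in
    let c2 := cross l1 l2 in
    let Z := fun s : R => c0 + s *: c1 + s ^+ 2 *: c2 in
    let L := fun s : R => line p (side_pt P i s) in
    let S := [set s : R | 0 < s < 1 /\ C (L s)] in
    [/\ C = L @` S,
        forall s, S s ->
          [/\ Delta0 + s * Delta1 != 0, 0 < t s < 1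
            & L s `&` boundary P = [set side_pt P i s; side_pt P j (t s)]],
        (forall s, ell s = l0 + s *: l1 + s ^+ 2 *: l2) /\
        (forall s, S s -> line_coords (ell s) (reflected_line P (L s))),
        forall s, S s -> regular s ->
          forall w, envelope_pt (fun r => reflected_line P (L r)) s w
                    <-> same_point (Z s) w
      & [/\ param_conic c0 c1 c2 \/ param_degenerate_conic c0 c1 c2,
            forall s, S s -> regular s -> Z s 0 2%:R != 0
          & cell_envelope P p C
            = [set affine (Z s) | s in S `&` [set s | regular s]]]])
  /\
  (no_line_through_two_vertices P p ->
    [set C | cell P p C] #= `I_(n.*2) /\
    exists (A : 'I_(n.*2) -> set 'rV[R]_2) (T : 'Z_(n.*2) -> set 'rV[R]_2),
      [/\ forall k, conic_arc (A k)
                    /\ exists2 C, cell P p C & A k = cell_envelope P p C,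
          forall k, transition_segment P p k (T k)
        & ART P p = (\bigcup_k A k) `|` (\bigcup_k T k)]).
Proof.
have hin j := interior_det2_gt0 hP j hp.
split.
  move=> C i j [aC Cij _] D0 D1 N0 N1 t u0 u1 v0 v1 l0 l1 l2 ell regular c0 c1 c2 Z L S.
  have Cp : C `<=` pencil p.
    by case: aC => a [b [_ _ ->]] _ [theta _ <-]; exists theta.
  have ellE : ell = refl_coords P p i j.
    by apply/funext => s; rewrite /ell cross_bilinear.
  have cS s : S s -> crosses_sides P p (chord_dir P p i s) i j by exact: cell_crosses.
  have Z2 s : S s -> Z s 0 2%:R != 0.
    by move=> /cS/(crosses_third_gt0 hP hin); rewrite lt0r => /andP[].
  have reg s : S s -> regular s.
    move=> Ss; rewrite /regular ellE cross_refl_coords_derive.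
    by apply: contraNneq (Z2 _ Ss) => e; rewrite -[Z s]/(envelope_curve P p i j s) e mxE.
  split.
  - exact: (cell_image hP hin Cp Cij).
  - move=> s /cS c; have /and3P[ij hi hj] := c.
    have := crosses_chord hP hin c; have := crossing_par_itv hj.
    rewrite line_chord_dir (crossing_par_chord_dir_self hin) crossing_par_chord_dir.
    move=> tj chord; split=> //.
    by rewrite -(offset_chord_dirD P p) subr_eq0 prod_lt0_neq.
  - split=> s; first by rewrite ellE.
    by move=> /cS c; rewrite ellE; apply: refl_line_coords.
  - by move=> s Ss _ w; apply: envelope_side => //; exact: cS.
  split; [exact: param_conicP|by move=> s Ss _; exact: Z2|].
  rewrite (cell_envelopeE hP hin Cp Cij); congr (image _ _).
  by apply/seteqP; split=> s => [Ss|[]//]; split=> //; exact: reg.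
move=> no2.
have preg : region P p := interior_subset hp.
have vertex_neq k : P k - p != 0.
  have := hin k; rewrite -opprB det2Nr; apply: contraTneq => ->.
  by rewrite det20 oppr0 ltxx.
have [phi phiP] := choice (fun k => polar_line (vertex_neq k)).
have [rho polar] := choice phiP.
have phi_itv k : 0 <= phi k < pi by have [] := polar k.
have rho0 k : rho k != 0 by have [] := polar k.
have polarP k : P k - p = rho k *: dir (phi k) by have [] := polar k.
split; first exact: (card_cells hP hin preg phi_itv rho0 polarP no2).
have n2 : (1 < n.*2)%N.
  by case: hP => n1 _ _ _ _; rewrite (leq_trans n1) // -addnn leq_addr.
have exT k : exists T, transition_segment P p k T /\
    forall T', transition_segment P p k T' -> T' = T.
  have [T T1 T2] := transition_segment_unique hP hin preg phi_itv rho0 polarP no2 k.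
  by exists T.
have [T TP] := choice exT.
have cellP := cell_vertex_cell hP hin preg phi_itv rho0 polarP.
(* 'I_(n.*2) and 'Z_(n.*2) are equal only propositionally. *)
pose cell_of (k : 'I_(n.*2)) := vertex_cell p phi (cast_ord (esym (Zp_cast n2)) k).
exists (fun k => cell_envelope P p (cell_of k)), T; split.
- move=> k; split; first exact: (conic_arc_vertex_cell hP hin preg phi_itv rho0 polarP).
  by exists (cell_of k) => //; exact: cellP.
- by move=> k; have [] := TP k.
apply/seteqP; split=> z.
  move=> [[C /(cell_is_vertex_cell hP hin phi_itv rho0 polarP)[k ->] Cz]|[k [T' /(TP k).2 -> Tz]]].
    left; exists (cast_ord (Zp_cast n2) k) => //=.
    by rewrite /cell_of cast_ordK.
  by right; exists k.
move=> [[k _ Az]|[k _ Tz]].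
  by left; exists (cell_of k) => //; exact: cellP.
by right; exists k, (T k) => //; have [] := TP k.
Qed.
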